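(* Let $A$ be a finite set, $n\ge3$, $1\le r\le n$, and let $\rho\subseteq A^n$ be an essential key relation preserved by a WNU whose pattern is the equivalence relation with classes $\{1,\dots,r\},\{r+1\},\{r+2\},\dots,\{n\}$. Then for every key tuple $(a_1,\dots,a_n)$ of $\rho$ there exist sets $B_1,\dots,B_n\subseteq A$, a prime $p$, bijections $\phi_i:B_i\to\mathbb Z_p$ for $i=1,\dots,r$, and elements $b_{r+1},\dots,b_n\in A$ with $b_i\neq a_i$, such that, writing $\boldsymbol B=B_1\times\dots\times B_n$: $(a_1,\dots,a_n)\in\boldsymbol B$; $B_i=\{a_i,b_i\}$ for $i=r+1,\dots,n$; $$\rho\cap\boldsymbol B=\{(x_1,\dots,x_n)\in\boldsymbol B:\ \phi_1(x_1)+\dots+\phi_r(x_r)=0 \text{ in }\mathbb Z_p,\ \text{or } x_i=b_i\text{ for some } i\in\{r+1,\dots,n\}\};$$ and every tuple $\gamma\in\boldsymbol B\setminus\rho$ is a key tuple for $\rho$.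
   Context: A unary vector-function is a tuple $\Psi=(\psi_1,\dots,\psi_n)$ of maps $\psi_i:A\to A$ acting coordinatewise; it preserves $\rho$ if $\Psi(\rho)\subseteq\rho$. $\rho\subseteq A^n$ is a key relation if there is $\beta\in A^n\setminus\rho$ (a key tuple) such that every $\alpha\in A^n\setminus\rho$ is mapped to $\beta$ by some unary vector-function preserving $\rho$. $\rho$ is essential if it cannot be written as a conjunction of relations of smaller arities. A WNU is an $m$-ary ($m\ge2$) operation $f$ on $A$ with $f(x,\dots,x)=x$ and $f(y,x,\dots,x)=f(x,y,x,\dots,x)=\dots=f(x,\dots,x,y)$; it preserves $\rho$ if applying it coordinatewise to any $m$ tuples of $\rho$ gives a tuple of $\rho$. The pattern of $\rho$: for $i\ne j$, $i\overset{\rho}{\sim}j$ iff there do NOT exist $a_1,\dots,a_n,b_i,b_j\in A$ with $(a_1,\dots,a_n)\notin\rho$ while the tuples obtained by replacing $a_i$ by $b_i$, replacing $a_j$ by $b_j$, and replacing both, all lie in $\rho$; and $i\overset{\rho}{\sim}i$ always. *)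

(* Defs.v *)
(* Tuples in A^n are finite functions {ffun 'I_n -> A};
   coordinates are indexed 0..n-1 (paper's index i corresponds to i-1). *)
From HB Require Import structures.
From mathcomp Require Import all_boot all_order all_algebra.
Set Implicit Arguments. Unset Strict Implicit. Unset Printing Implicit Defensive.

Section Defs.
Variables (A : finType) (n : nat).
Notation tup := {ffun 'I_n -> A}.

Definition vapply (Psi : 'I_n -> A -> A) (x : tup) : tup :=
  [ffun i => Psi i (x i)].

Definition vpreserves (Psi : 'I_n -> A -> A) (rho : {set tup}) : Prop :=
  forall x, x \in rho -> vapply Psi x \in rho.

Definition is_key_tuple (rho : {set tup}) (beta : tup) : Prop :=
  beta \notin rho /\
  forall alpha, alpha \notin rho ->
    exists Psi : 'I_n -> A -> A, vpreserves Psi rho /\ vapply Psi alpha = beta.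

Definition key_relation (rho : {set tup}) : Prop :=
  exists beta, is_key_tuple rho beta.

Definition essential (rho : {set tup}) : Prop :=
  ~ exists (m : nat) (k : 'I_m -> nat)
      (idx : forall l : 'I_m, 'I_(k l) -> 'I_n)
      (sig : forall l : 'I_m, {set {ffun 'I_(k l) -> A}}),
      (forall l, k l < n) /\
      forall x : tup, x \in rho <-> forall l, [ffun j => x (idx l j)] \in sig l.

Definition is_WNU (m : nat) (f : ('I_m -> A) -> A) : Prop :=
  2 <= m /\
  (forall x : A, f (fun _ => x) = x) /\
  (forall (x y : A) (i j : 'I_m),
      f (fun k => if k == i then y else x) = f (fun k => if k == j then y else x)).

Definition op_preserves (m : nat) (f : ('I_m -> A) -> A) (rho : {set tup}) : Prop :=
  forall t : 'I_m -> tup, (forall k, t k \in rho) ->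
    [ffun i => f (fun k => t k i)] \in rho.

Definition upd (x : tup) (i : 'I_n) (b : A) : tup :=
  [ffun k => if k == i then b else x k].

Definition pattern (rho : {set tup}) (i j : 'I_n) : Prop :=
  i = j \/
  (i <> j /\ ~ exists (a : tup) (bi bj : A),
      [/\ a \notin rho, upd a i bi \in rho, upd a j bj \in rho &
          upd (upd a i bi) j bj \in rho]).

End Defs.

(* Main.v *)
(** Restrict to a minimal retract ([core]) on which every vector-function that
    preserves [rho] and sends the key tuple [a] to a tuple outside [rho] is bijective.
    Freezing the arguments of the WNU at tuples of [rho] then yields unary polynomials
    that are either bijective or send [a] into [rho].  A coordinate is collapsible when
    some preserving map is non-bijective there only; such a map provides [b_j].  If
    [j] is inequivalent to [i] and not collapsible, bijective polynomials of two
    complementary argument sets cannot coexist ([not_both_binj]).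
    - For [r <= 2], either a coordinate collapses and one inducts on the active
      coordinates, or the [m] arguments split into three parts on none of which the
      polynomial is bijective, and inserting there the witnesses of three frozen
      subproblems produces [b_1, ..., b_n] simultaneously.
    - For [r >= 3], rectangularity forces the polynomial of a single argument to be
      bijective, so all coordinates after [r] collapse, and [f(x, y, o, ..., o)] becomes
      an addition with unit [o], whose translations generate a cyclic group; an element
      of prime order of this group gives the box, moved back to [a] by keyness. *)
Require Import Defs.
From HB Require Import structures.
From mathcomp Require Import all_boot all_order all_algebra.
From mathcomp Require Import fingroup perm ring.
From Stdlib Require Import Classical FunctionalExtensionality.
Import GRing.Theory.
Set Implicit Arguments. Unset Strict Implicit. Unset Printing Implicit Defensive.

(** * Vector-functions preserving [rho] on a box, and inverting the bijective ones *)

Section Boxes.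
Variables (A : finType) (n : nat) (rho : {set {ffun 'I_n -> A}}).
Notation tup := {ffun 'I_n -> A}.
Implicit Types (B : 'I_n -> {set A}) (Psi Phi : 'I_n -> A -> A).

Definition boxed B (x : tup) := forall l, x l \in B l.

Definition bmap B Psi :=
  (forall l x, x \in B l -> Psi l x \in B l) /\
  (forall x : tup, boxed B x -> x \in rho -> vapply Psi x \in rho).

Definition binj B Psi := forall l, {in B l &, injective (Psi l)}.

Definition vcomp Psi Phi : 'I_n -> A -> A := fun l => Psi l \o Phi l.

Lemma vapply_comp Psi Phi (x : tup) :
  vapply (vcomp Psi Phi) x = vapply Psi (vapply Phi x).
Proof. by apply/ffunP=> l; rewrite !ffunE. Qed.

Lemma vapply_boxed B Psi x : bmap B Psi -> boxed B x -> boxed B (vapply Psi x).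
Proof. by move=> [h _] bx l; rewrite ffunE; apply: h. Qed.

Lemma bmap_comp B Psi Phi : bmap B Psi -> bmap B Phi -> bmap B (vcomp Psi Phi).
Proof.
move=> hP hQ; split=> [l x xB|x bx rx]; first by apply: hP.1; apply: hQ.1.
by rewrite vapply_comp; apply: hP.2; [apply: vapply_boxed|apply: hQ.2].
Qed.

Lemma bmap_id B : bmap B (fun _ x => x).
Proof.
split=> // x _ rx; suff -> : vapply (fun _ x => x) x = x by [].
by apply/ffunP=> l; rewrite ffunE.
Qed.

Lemma bmap_iter B Psi k : bmap B Psi -> bmap B (fun l => iter k (Psi l)).
Proof.
by move=> hP; elim: k => [|k IH]; [apply: bmap_id|apply: (bmap_comp hP IH)].
Qed.

(** One exponent serves all coordinates at once: [Psi], extended by the identity off the box,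
    permutes the finite set of pairs (coordinate, value), and [N.+1] is the order of this
    permutation. *)
Lemma iter_binj_id B Psi :
    (forall l x, x \in B l -> Psi l x \in B l) -> binj B Psi ->
  exists N, forall l x, x \in B l -> iter N.+1 (Psi l) x = x.
Proof.
move=> st inj.
pose h (u : 'I_n * A) := (u.1, if u.2 \in B u.1 then Psi u.1 u.2 else u.2).
have hinj : injective h.
  move=> [l x] [l' y] [/= <-].
  case: ifP => xB; case: ifP => yB.
  - by move/(inj l _ _ xB yB)=> ->.
  - by move=> e; move: (st l x xB); rewrite e yB.
  - by move=> e; move: (st l y yB); rewrite -e xB.
  - by move=> ->.
pose p := perm hinj; exists #[p]%g.-1 => l x xB.
have itB k : iter k (Psi l) x \in B l by elim: k => //= k IH; apply: st.
have ith k : iter k p (l, x) = (l, iter k (Psi l) x).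
  by elim: k => //= k ->; rewrite permE /h /= itB.
rewrite prednK ?order_gt0 //.
have := ith #[p]%g; rewrite -permX expg_order perm1.
by case.
Qed.

(** The inverse is an iterate of [Psi], which is why it preserves [rho] too. *)
Lemma binj_inv B Psi : bmap B Psi -> binj B Psi ->
  exists Phi, [/\ bmap B Phi, forall l x, x \in B l -> Phi l (Psi l x) = x &
                  forall l x, x \in B l -> Psi l (Phi l x) = x].
Proof.
move=> hP inj; have [N hN] := iter_binj_id hP.1 inj.
exists (fun l => iter N (Psi l)); split; first exact: bmap_iter.
  by move=> l x xB; rewrite -iterSr hN.
by move=> l x xB; rewrite -iterS hN.
Qed.

Lemma binj_bad B Psi x : bmap B Psi -> binj B Psi -> boxed B x ->
  vapply Psi x \in rho -> x \in rho.
Proof.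
move=> hP inj bx r; have [Phi [hQ QP _]] := binj_inv hP inj.
have -> : x = vapply Phi (vapply Psi x).
  by apply/ffunP=> l; rewrite !ffunE QP.
by apply: hQ.2 r; apply: vapply_boxed.
Qed.

(** The inner map [Phi] is injective, hence onto the finite box, so injectivity of the composite
    passes to [Psi]. *)
Lemma binj_comp B Psi Phi :
  bmap B Psi -> bmap B Phi -> binj B (vcomp Psi Phi) -> binj B Psi.
Proof.
move=> hP hQ inj.
have [Xi [hX XP PX]] := binj_inv (bmap_comp hP hQ) inj.
have injQ : binj B Phi.
  by move=> l x y xB yB e; apply: (inj l) => //=; rewrite /vcomp /= e.
have [Om [hO OP PO]] := binj_inv hQ injQ.
move=> l x y xB yB e; rewrite -(PO l x xB) -(PO l y yB); congr (Phi l _).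
by apply: (inj l); rewrite ?hO.1 //= /vcomp /= !PO.
Qed.

Lemma updE (x : tup) i b l : upd x i b l = if l == i then b else x l.
Proof. by rewrite ffunE. Qed.

Lemma upd_id (x : tup) i : upd x i (x i) = x.
Proof. by apply/ffunP=> l; rewrite ffunE; case: eqP => [->|]. Qed.

Lemma updC (x : tup) i j b c : i != j -> upd (upd x i b) j c = upd (upd x j c) i b.
Proof.
move=> ij; apply/ffunP=> l; rewrite !ffunE.
by case: (l =P j) => // ->; rewrite eq_sym (negbTE ij).
Qed.

Lemma upd_boxed B x i b : boxed B x -> b \in B i -> boxed B (upd x i b).
Proof. by move=> bx bB l; rewrite ffunE; case: eqP => [->|]. Qed.

Lemma vapply_upd Psi (x : tup) i b :
  vapply Psi (upd x i b) = upd (vapply Psi x) i (Psi i b).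
Proof. by apply/ffunP=> l; rewrite !ffunE; case: eqP => [->|]. Qed.

End Boxes.

Lemma ex_measure_min (T : Type) (P : T -> Prop) (mu : T -> nat) :
  (exists x, P x) -> exists x, P x /\ forall y, P y -> mu x <= mu y.
Proof.
case=> x; have [k] := ubnP (mu x); elim: k x => // k IH x ltk Px.
case: (classic (exists y, P y /\ mu y < mu x)) => [[y [Py lty]]|no].
  by apply: (IH y) => //; apply: leq_trans lty _.
exists x; split=> // y Py; rewrite leqNgt; apply/negP=> lt; apply: no.
by exists y.
Qed.

(** * Minimal retracts around the key tuple *)

Section Core.
Variables (A : finType) (n : nat) (rho : {set {ffun 'I_n -> A}}).
Variable a : {ffun 'I_n -> A}.
Notation tup := {ffun 'I_n -> A}.
Implicit Types (I : {set 'I_n}) (B : 'I_n -> {set A}) (Psi Phi : 'I_n -> A -> A).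

(* The coordinates outside [I] are frozen at [a]; [r] is a retraction onto the box and
   [F l] is the WNU followed by [r l]. *)
Record core I B (r : 'I_n -> A -> A) (m : nat) (F : 'I_n -> ('I_m -> A) -> A)
    : Prop := Core {
  core_bad : a \notin rho;
  core_base : boxed B a;
  core_off : forall l, l \notin I -> B l = [set a l];
  core_ret : forall l x, r l x \in B l;
  core_fix : forall l x, x \in B l -> r l x = x;
  core_retP : forall x : tup, x \in rho -> (forall l, l \notin I -> x l = a l) ->
    vapply r x \in rho;
  core_key : forall k : tup, boxed B k -> k \notin rho ->
    exists2 Theta, bmap rho B Theta & vapply Theta k = a;
  core_inj : forall Psi, bmap rho B Psi -> vapply Psi a \notin rho -> binj B Psi;
  core_arity : 1 < m;
  core_FB : forall l u, F l u \in B l;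
  core_idem : forall l x, x \in B l -> F l (fun _ => x) = x;
  core_wnu : forall l x y p q,
    F l (fun k => if k == p then y else x) = F l (fun k => if k == q then y else x);
  core_pres : forall t : 'I_m -> tup, (forall k, boxed B (t k)) ->
    (forall k, t k \in rho) -> [ffun l => F l (fun k => t k l)] \in rho }.

(** Take a map [e] of least total image size among those that fix [a], are constant outside [I], and
    preserve the slice of [rho] that agrees with [a] outside [I]; the box consists of its images.
    Minimality gives [core_inj], because keyness turns every preserving map that keeps [a] outside
    [rho] into a competitor of [e]. *)
Lemma core_exists I m (f : ('I_m -> A) -> A) :
    is_key_tuple rho a -> is_WNU f -> op_preserves f rho ->
  exists B r F, core I B r (m := m) F.
Proof.
move=> [abad akey] [m1 [fid fwnu]] fpres.
pose P (e : 'I_n -> A -> A) := [/\ forall l, e l (a l) = a l,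
  forall l x, l \notin I -> e l x = a l &
  forall x : tup, x \in rho -> (forall l, l \notin I -> x l = a l) ->
    vapply e x \in rho].
pose mu (e : 'I_n -> A -> A) := \sum_l #|e l @: setT|.
have [|e [[ea eoff er] emin]] := @ex_measure_min _ P mu.
  exists (fun l x => if l \in I then x else a l); split.
  - by move=> l; case: ifP.
  - by move=> l x /negbTE ->.
  - move=> x xr xoff; suff -> : vapply (fun l x => if l \in I then x else a l) x = x by [].
    by apply/ffunP=> l; rewrite ffunE; case: ifPn => // /xoff ->.
pose B l := e l @: setT.
have eB l x : e l x \in B l by apply: imset_f; rewrite inE.
have offB l : l \notin I -> B l = [set a l].
  move=> lI; apply/setP=> x; rewrite inE; apply/imsetP/eqP => [[y _ ->]|->].
    exact: eoff.
  by exists (a l); rewrite ?inE ?ea.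
have aB : boxed B a by move=> l; rewrite -{1}(ea l).
have boff x : boxed B x -> forall l, l \notin I -> x l = a l.
  by move=> bx l lI; move: (bx l); rewrite (offB l lI) inE => /eqP.
have vea : vapply e a = a by apply/ffunP=> l; rewrite ffunE ea.
have key0 (k : tup) : boxed B k -> k \notin rho ->
    exists2 Theta, bmap rho B Theta & vapply Theta k = a.
  move=> bk kbad; have [Th [Thr Thk]] := akey k kbad.
  exists (vcomp e Th); last by rewrite vapply_comp Thk.
  split=> [l x xB|x bx xr]; first exact: eB.
  rewrite vapply_comp; apply: er; first exact: Thr.
  move=> l lI; rewrite ffunE (boff x bx l lI).
  by have := congr1 (fun t : tup => t l) Thk; rewrite !ffunE (boff k bk l lI).
have inj0 Psi : bmap rho B Psi -> vapply Psi a \notin rho -> binj B Psi.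
  move=> hP bad.
  have [Th hT Tha] := key0 _ (vapply_boxed hP aB) bad.
  (* If [Psi] were not injective on some [B l], the competitor [c] would have a smaller total image
     than [e]. *)
  pose c := vcomp (vcomp Th Psi) e.
  have Pc : P c.
    split=> [l|l x lI|x xr xoff].
    - have := congr1 (fun t : tup => t l) Tha.
      by rewrite !ffunE /c /vcomp /= ea.
    - apply/set1P; rewrite -(offB l lI); apply: hT.1; apply: hP.1; exact: eB.
    - rewrite /c (vapply_comp (vcomp Th Psi)) (vapply_comp Th); have bex : boxed B (vapply e x).
        by move=> l; rewrite ffunE.
      apply: hT.2; first exact: vapply_boxed hP bex.
      by apply: hP.2 => //; apply: er.
  have cle l : #|c l @: setT| <= #|Psi l @: B l|.
    have -> : c l @: setT = Th l @: (Psi l @: (e l @: setT)).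
      by rewrite -!imset_comp.
    exact: leq_imset_card.
  have Ple l : #|Psi l @: B l| <= #|B l| by apply: leq_imset_card.
  move=> l; apply/imset_injP; rewrite eqn_leq Ple /=.
  rewrite leqNgt; apply/negP=> lt.
  have := emin _ Pc; rewrite leqNgt => /negP; apply.
  rewrite /mu (bigD1 l) //= [X in _ < X](bigD1 l) //= -addSn.
  apply: leq_add; first exact: leq_ltn_trans (cle l) lt.
  by apply: leq_sum => i _; apply: leq_trans (cle i) (Ple i).
have hbe : bmap rho B e.
  split=> [l x _|x bx xr]; first exact: eB.
  by apply: er => //; apply: boff.
have einj : binj B e by apply: inj0; rewrite ?vea.
(* [e] need not be idempotent, but it permutes the box, so some power of it is the identity there
   and is therefore a retraction. *)
have [N hN] := iter_binj_id hbe.1 einj.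
pose r l := iter N.+1 (e l).
have rr x : x \in rho -> (forall l, l \notin I -> x l = a l) -> vapply r x \in rho.
  move=> xr xoff; rewrite /r.
  have -> : vapply (fun l => iter N.+1 (e l)) x
          = vapply (fun l => iter N (e l)) (vapply e x).
    by apply/ffunP=> l; rewrite !ffunE iterSr.
  apply: (bmap_iter N hbe).2; last exact: er.
  by move=> l; rewrite ffunE.
exists B, r, (fun l u => r l (f u)); split=> //.
- by move=> l x; rewrite /r /=.
- by move=> l u; rewrite /r /=.
- by move=> l x xB; rewrite fid; apply: hN.
- by move=> l x y p q; rewrite (fwnu x y p q).
- move=> t tB tr.
  have -> : [ffun l => r l (f (fun k => t k l))]
      = vapply r [ffun l => f (fun k => t k l)] by apply/ffunP=> l; rewrite !ffunE.
  apply: rr; first exact: fpres.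
  move=> l lI; rewrite ffunE.
  have -> : (fun k => t k l) = (fun _ => a l).
    by apply: functional_extensionality => k; apply: boff.
  exact: fid.
Qed.

End Core.

(** * Unary polynomials of the WNU and collapsible coordinates *)

Section InCore.
Variables (A : finType) (n : nat) (rho : {set {ffun 'I_n -> A}}).
Variables (a : {ffun 'I_n -> A}) (I : {set 'I_n}) (B : 'I_n -> {set A}).
Variables (r : 'I_n -> A -> A) (m : nat) (F : 'I_n -> ('I_m -> A) -> A).
Hypothesis C : core rho a I B r F.
Notation tup := {ffun 'I_n -> A}.
Implicit Types (S : {set 'I_m}) (T : 'I_m -> tup) (Psi Phi : 'I_n -> A -> A).

Definition good (x : tup) := boxed B x /\ x \in rho.

(** The unary polynomial obtained by freezing the arguments outside [S]; [T] is total, but its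
    values on [S] are ignored. *)
Definition fpoly S T : 'I_n -> A -> A :=
  fun l x => F l (fun k => if k \in S then x else T k l).

Lemma vapply_fpoly S T (x : tup) :
  vapply (fpoly S T) x = [ffun l => F l (fun k => (if k \in S then x else T k) l)].
Proof.
apply/ffunP=> l; rewrite !ffunE /fpoly; congr (F l _).
by apply: functional_extensionality => k; case: ifP.
Qed.

Lemma good_F T : (forall k, good (T k)) -> good [ffun l => F l (fun k => T k l)].
Proof.
move=> hT; split=> [l|]; first by rewrite ffunE; apply: core_FB C _ _.
by apply: core_pres C _ _ _ => k; case: (hT k).
Qed.

Lemma fpoly_bmap S T : (forall k, k \notin S -> good (T k)) -> bmap rho B (fpoly S T).
Proof.
move=> hT; split=> [l x _|x bx xr]; first exact: core_FB C _ _.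
rewrite vapply_fpoly; apply: (good_F (T := fun k => if k \in S then x else T k) _).2 => k.
by case: ifPn => [//|/hT].
Qed.

Lemma fpoly_eq S T T' l : (forall k, k \notin S -> T k l = T' k l) ->
  fpoly S T l =1 fpoly S T' l.
Proof.
move=> e x; congr (F l _); apply: functional_extensionality => k.
by case: ifPn => // /e.
Qed.

Lemma fpoly_fix S T l x : x \in B l -> (forall k, k \notin S -> T k l = x) ->
  fpoly S T l x = x.
Proof.
move=> xB e; rewrite /fpoly -[RHS](core_idem C xB); congr (F l _).
by apply: functional_extensionality => k; case: ifPn => // /e.
Qed.

Lemma eq_in_inj (D : {set A}) (f g : A -> A) :
  {in D, f =1 g} -> {in D &, injective f} -> {in D &, injective g}.
Proof. by move=> e inj x y xD yD; rewrite -!e //; apply: inj. Qed.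

Definition collapsible l := exists Psi, [/\ bmap rho B Psi,
  forall i, i != l -> {in B i &, injective (Psi i)} &
  ~ {in B l &, injective (Psi l)}].

Lemma collapsible_retract l : collapsible l -> exists Psi,
  [/\ bmap rho B Psi, forall i x, i != l -> x \in B i -> Psi i x = x & ~ binj B Psi].
Proof.
move=> [Psi [hP inj ninj]].
(* The identity at [l] makes [Phi] bijective, so a single exponent turns [Psi] into the identity at
   all the other coordinates. *)
pose Phi i := if i == l then id else Psi i.
have [i x xB|i|N hN] := @iter_binj_id A n B Phi.
- by rewrite /Phi; case: ifP => // _; apply: hP.1.
- rewrite /Phi; case: ifPn => [_ //|il]; exact: inj.
exists (fun i => iter N.+1 (Psi i)); split.
- exact: bmap_iter.
- by move=> i x il xB; rewrite -[RHS](hN i x xB) /Phi (negbTE il).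
- move=> binjN; apply: ninj => x y xB yB e; apply: (binjN l) => //.
  by rewrite !iterSr e.
Qed.

(** The orbit of [a] under the preserving maps of the box. Its tuples inherit the rigidity of [a]
    ([reach_binj]) and, if outside [rho] in a core with all coordinates active, its keyness
    ([reach_key]). *)
Definition reach (k : tup) := exists2 Om, bmap rho B Om & vapply Om a = k.

Lemma reach_base : reach a.
Proof. by exists (fun _ x => x); [exact: bmap_id|apply/ffunP=> l; rewrite ffunE]. Qed.

Lemma reach_vapply Psi k : bmap rho B Psi -> reach k -> reach (vapply Psi k).
Proof.
move=> hP [Om hO <-]; exists (vcomp Psi Om); first exact: bmap_comp.
exact: vapply_comp.
Qed.

Lemma reach_binj k Psi :
  reach k -> bmap rho B Psi -> vapply Psi k \notin rho -> binj B Psi.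
Proof.
move=> [Om hO <-] hP bad; apply: (binj_comp hP hO).
by apply: core_inj C _ (bmap_comp hP hO) _; rewrite vapply_comp.
Qed.

(** The value is the image of [a l] under a non-bijective map that moves only coordinate [l].
    Applied to a reachable tuple, that map must land in [rho], since otherwise rigidity would make
    it bijective. *)
Lemma collapsible_val l : collapsible l -> exists2 b, b \in B l &
  forall k, boxed B k -> k l = a l -> k \in rho \/ reach k -> upd k l b \in rho.
Proof.
move=> /collapsible_retract [Psi [hP Pid ninj]].
exists (Psi l (a l)); first by apply: hP.1; apply: core_base C _.
move=> k bk kl kgood.
have <- : vapply Psi k = upd k l (Psi l (a l)).
  apply/ffunP=> i; rewrite !ffunE; case: eqP => [->|/eqP il]; first by rewrite kl.
  exact: Pid.
case: kgood => [|kr]; first exact: hP.2.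
by apply/negPn/negP=> bad; apply: ninj; apply: reach_binj kr hP bad.
Qed.

(* If both were bijective, [F] with [x] on [S1], [y] on [S2] and [t] elsewhere would be,
   up to isotopy, a loop with unit [t]; dividing [t1] out of [t2] in it gives [a]. *)
Lemma not_both_binj i j ci cj S1 S2 : i != j -> ci \in B i -> cj \in B j ->
    upd a i ci \in rho -> upd a j cj \in rho ->
    upd (upd a i ci) j cj \in rho -> ~ collapsible j -> [disjoint S1 & S2] ->
  binj B (fpoly S1 (fun _ => upd a i ci)) -> ~ binj B (fpoly S2 (fun _ => upd a i ci)).
Proof.
move=> ij ciB cjB; set t := upd a i ci; set t2 := upd a j cj; set t1 := upd t j cj.
move=> tr t2r t1r ncj dis inj1 inj2.
have aB := core_base C.
have tB : boxed B t by apply: upd_boxed.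
have t1B : boxed B t1 by apply: upd_boxed.
have t2B : boxed B t2 by apply: upd_boxed.
have tg : good t by [].
have h1 : bmap rho B (fpoly S1 (fun _ => t)) by apply: fpoly_bmap.
have [al [hal al1 al2]] := binj_inv h1 inj1.
have alt l : al l (t l) = t l.
  by rewrite -{1}(@fpoly_fix S1 (fun _ => t) l (t l)) // al1.
pose s1 := vapply al t1; pose s2 := vapply al t2.
have s1g : good s1 by split; [exact: vapply_boxed hal t1B|apply: hal.2].
have s2g : good s2 by split; [exact: vapply_boxed hal t2B|apply: hal.2].
have s1E l : l != j -> s1 l = t l.
  by move=> lj; rewrite ffunE updE (negbTE lj) alt.
pose T1 k := if k \in S1 then s1 else t.
have T1E l k : l != j -> T1 k l = t l.
  by move=> lj; rewrite /T1; case: ifP => // _; apply: s1E.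
have hpi : bmap rho B (fpoly S2 T1) by apply: fpoly_bmap => k _; rewrite /T1; case: ifP.
have injpi : binj B (fpoly S2 T1).
  have injl l : l != j -> {in B l &, injective (fpoly S2 T1 l)}.
    move=> lj; apply: eq_in_inj (inj2 l) => x _; apply: fpoly_eq => k _.
    by rewrite T1E.
  move=> l; case: (l =P j) => [->|/eqP]; last exact: injl.
  by apply: NNPP => ninj; apply: ncj; exists (fpoly S2 T1).
have [pi' [hpi' pi1 pi2]] := binj_inv hpi injpi.
pose z := vapply pi' t.
have zg : good z by split; [exact: vapply_boxed hpi' tB|apply: hpi'.2].
have zE l : l != j -> z l = t l.
  move=> lj; rewrite ffunE -{1}(@fpoly_fix S2 T1 l (t l)) ?pi1 // => k _.
  by rewrite T1E.
(* At [j], [s2] agrees with [s1], so the result is [t j = a j] by the choice of [z]. At any other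
   coordinate [z] agrees with [t], so the result is [t2 l = a l] by the choice of [s2]. Thus [F]
   would produce [a] from tuples of [rho]. *)
pose T2 k := if k \in S2 then z else if k \in S1 then s2 else t.
have [_] : good [ffun l => F l (fun k => T2 k l)].
  by apply: good_F => k; rewrite /T2; case: ifP => // _; case: ifP.
apply/negP; suff -> : [ffun l => F l (fun k => T2 k l)] = a by exact: core_bad C.
apply/ffunP=> l; rewrite ffunE.
have Edis k : k \in S2 -> k \in S1 = false by move=> kS; apply: (disjointFl dis).
case: (l =P j) => [->|/eqP lj].
  transitivity (fpoly S2 T1 j (pi' j (t j))); last first.
    by rewrite pi2 // updE eq_sym (negbTE ij).
  congr (F j _); apply: functional_extensionality => k; rewrite /T2 /T1.
  case: ifP => _; first by rewrite /z ffunE.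
  by case: ifP => // _; rewrite /s2 /s1 !ffunE eqxx.
transitivity (fpoly S1 (fun _ => t) l (al l (a l))); last by rewrite al2.
congr (F l _); apply: functional_extensionality => k; rewrite /T2.
case: ifP => kS2; first by rewrite zE // Edis.
by case: ifP => // _; rewrite /s2 !ffunE (negbTE lj).
Qed.

(** By the WNU identity all one-argument polynomials with the same frozen tuple coincide, so
    bijectivity at [p] would give it at a second argument [q], and [[set p]], [[set q]] are
    disjoint. *)
Lemma single_not_binj i j ci cj p : i != j -> ci \in B i -> cj \in B j ->
    upd a i ci \in rho -> upd a j cj \in rho ->
    upd (upd a i ci) j cj \in rho -> ~ collapsible j ->
  ~ binj B (fpoly [set p] (fun _ => upd a i ci)).
Proof.
move=> ij ciB cjB cir cjr cijr nc inj.
have [q qp] : exists q : 'I_m, q != p.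
  have m1 := core_arity C.
  case: (p =P Ordinal m1) => [->|/eqP pq]; last by exists (Ordinal m1); rewrite eq_sym.
  by exists (Ordinal (ltnW m1)).
have dis : [disjoint [set p] & [set q]] by rewrite disjoints1 inE eq_sym.
apply: (not_both_binj ij ciB cjB cir cjr cijr nc dis inj) => l.
apply: eq_in_inj (inj l) => x _; rewrite /fpoly.
transitivity (F l (fun k => if k == p then x else upd a i ci l)).
  by congr (F l _); apply: functional_extensionality => k; rewrite inE.
rewrite (core_wnu C _ _ _ p q); congr (F l _).
by apply: functional_extensionality => k; rewrite inE.
Qed.

(** Paths along which a frozen argument can be moved one coordinate at a time. The starting tuple is
    unconstrained; every later one lies in the box and in [rho]. *)
Inductive linked : tup -> tup -> Prop :=
| linked_refl (x : tup) : linked x x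
| linked_step (x y z : tup) l :
    good y -> (forall i, i != l -> x i = y i) -> linked y z -> linked x z.

Lemma linked_trans x y z : linked x y -> linked y z -> linked x z.
Proof.
move=> lxy; elim: lxy => {x y}// x y w l yg e _ IH lw.
by apply: (linked_step yg e); apply: IH.
Qed.

Lemma linked1 (x y : tup) l : good y -> (forall i, i != l -> x i = y i) -> linked x y.
Proof. by move=> yg e; apply: (linked_step yg e); apply: linked_refl. Qed.

Definition put T p (x : tup) : 'I_m -> tup := fun k => if k == p then x else T k.

(** A step of the path changes the polynomial at one coordinate only; injectivity persists at the
    others, and then also there because that coordinate does not collapse. *)
Lemma binj_fpoly_put S T p x y : (forall l, ~ collapsible l) ->
    (forall k, k \notin S -> k != p -> good (T k)) -> linked x y -> good x ->
  binj B (fpoly S (put T p x)) -> binj B (fpoly S (put T p y)).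
Proof.
move=> nc hT lxy; elim: lxy => {x y}// x y z l yg exy _ IH xg inj.
apply: IH => //.
have injl i : i != l -> {in B i &, injective (fpoly S (put T p y) i)}.
  move=> il; apply: eq_in_inj (inj i) => v _; apply: fpoly_eq => k _.
  by rewrite /put; case: ifP => // _; apply: exy.
move=> i; case: (i =P l) => [->|/eqP]; last exact: injl.
apply: NNPP => ninj; apply: (nc l); exists (fpoly S (put T p y)); split=> //.
by apply: fpoly_bmap => k kS; rewrite /put; case: ifPn => // kp; apply: hT.
Qed.

Lemma binj_fpoly_linked S T t : (forall l, ~ collapsible l) -> good t ->
    (forall k, k \notin S -> good (T k) /\ linked (T k) t) ->
  binj B (fpoly S T) -> binj B (fpoly S (fun _ => t)).
Proof.
move=> nc tg hT inj.
pose U q k := if (k : 'I_m) < q then t else T k.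
have hU q : q <= m -> binj B (fpoly S (U q)).
  elim: q => [_|q IH qm]; first by rewrite (_ : U 0 = T).
  have {}IH := IH (ltnW qm); pose p := Ordinal qm.
  case: (boolP (p \in S)) => pS.
    move=> l; apply: eq_in_inj (IH l) => x _; apply: fpoly_eq => k kS.
    rewrite /U [in RHS]ltnS [in RHS]leq_eqVlt; case: eqP => //= e.
    have kp : k = p by apply: val_inj.
    by move: kS; rewrite kp pS.
  have Uput : U q.+1 = put (U q) p t.
    apply: functional_extensionality => k; rewrite /U /put ltnS leq_eqVlt -val_eqE /=.
    by case: eqP.
  have Uput' : U q = put (U q) p (T p).
    apply: functional_extensionality => k; rewrite /put; case: eqP => // ->.
    by rewrite /U /= ltnn.
  rewrite Uput; apply: (@binj_fpoly_put _ _ _ (T p)) => //.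
  - by move=> k kS kp; rewrite /U; case: ifP => // _; case: (hT k kS).
  - by case: (hT p pS).
  - by case: (hT p pS).
  - by rewrite -Uput'.
rewrite (_ : (fun _ => t) = U m); first exact: hU.
by apply: functional_extensionality => k; rewrite /U ltn_ord.
Qed.

End InCore.

(** * Simultaneous repair of the key tuple when the nontrivial class has at most two elements *)

Section Disjunctions.
Variables (A : finType) (n : nat) (rho : {set {ffun 'I_n -> A}}).
Variable a : {ffun 'I_n -> A}.
Notation tup := {ffun 'I_n -> A}.

Definition overwrite (b : 'I_n -> A) (T : {set 'I_n}) : tup :=
  [ffun i => if i \in T then b i else a i].

Lemma overwrite0 b : overwrite b set0 = a.
Proof. by apply/ffunP=> i; rewrite ffunE inE. Qed.

Lemma overwrite1 b l : overwrite b [set l] = upd a l (b l).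
Proof. by apply/ffunP=> i; rewrite !ffunE inE; case: eqP => [->|]. Qed.

Lemma overwriteD1 b l T : b l = a l -> overwrite b T = overwrite b (T :\ l).
Proof.
by move=> bl; apply/ffunP=> i; rewrite !ffunE !inE; case: eqP => [->|] //=; case: ifP.
Qed.

Lemma eq_overwrite b b' (T : {set 'I_n}) :
  {in T, b =1 b'} -> overwrite b T = overwrite b' T.
Proof. by move=> e; apply/ffunP=> i; rewrite !ffunE; case: ifP => // /e. Qed.

Lemma overwrite_boxed B b T :
  boxed B a -> (forall i, b i \in B i) -> boxed B (overwrite b T).
Proof. by move=> aB bB l; rewrite ffunE; case: ifP. Qed.

(* [E] is the nontrivial class of the pattern when it has two elements, and is empty when
   the pattern is trivial. *)
Variable E : {set 'I_n}.
Hypothesis E02 : E = set0 \/ exists i j, i != j /\ E = [set i; j].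
Hypothesis repair : forall i, exists x, upd a i x \in rho.
Hypothesis pairs : forall i j, i != j -> j \notin E -> exists ci cj,
  [/\ upd a i ci \in rho, upd a j cj \in rho & upd (upd a i ci) j cj \in rho].
Hypothesis rectE : forall i j x y, i \in E -> j \in E -> i != j ->
  upd a i x \in rho -> upd a j y \in rho -> upd (upd a i x) j y \notin rho.

Lemma set1_neqE i : [set i] != E.
Proof.
case: E02 => [->|[j [k [jk ->]]]]; first by rewrite -cards_eq0 cards1.
by apply/eqP=> /(congr1 (fun T : {set _} => #|T|)); rewrite cards1 cards2 jk.
Qed.

Section InCore.
Variables (I : {set 'I_n}) (B : 'I_n -> {set A}) (r : 'I_n -> A -> A).
Variables (m : nat) (F : 'I_n -> ('I_m -> A) -> A).
Hypothesis C : core rho a I B r F.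

Let aB : boxed B a := core_base C.
Let ra l : r l (a l) = a l := core_fix C (aB l).

(** For [E = [set i; j]] the overwritten tuple is outside [rho] by [rectE], so keyness gives a map
    [Th] from it to [a]. This map exchanges the two kinds of single repairs, hence sends [a] to a
    doubly repaired tuple, again outside [rho]. So [Th] is bijective, and its inverse reaches the
    overwritten tuple from [a]. *)
Lemma reach_overwriteE b : (forall i, b i \in B i) ->
  (forall i, i \in E -> upd a i (b i) \in rho) -> reach rho a B (overwrite b E).
Proof.
move=> bB; case: E02 => [->|[i [j [ij EE]]]] hb; first by rewrite overwrite0; apply: reach_base.
have iE : i \in E by rewrite EE !inE eqxx.
have jE : j \in E by rewrite EE !inE eqxx orbT.
have [k kdef] : exists k, k = overwrite b E by exists (overwrite b E).
rewrite -kdef; have kB : boxed B k by rewrite kdef; apply: overwrite_boxed.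
have kE : k = upd (upd a i (b i)) j (b j).
  rewrite kdef; apply/ffunP=> l; rewrite !ffunE EE !inE.
  by case: (l =P j) => [->|_]; rewrite ?orbT ?orbF //; case: eqP => [->|].
have kbad : k \notin rho by rewrite kE; apply: rectE => //; apply: hb.
have [Th hT Tk] := core_key C kB kbad.
have Tl l : Th l (k l) = a l.
  by transitivity (vapply Th k l); [rewrite /vapply ffunE|rewrite Tk].
have Ti : Th i (b i) = a i by rewrite -(Tl i) kE !ffunE eqxx (negbTE ij).
have Tj : Th j (b j) = a j by rewrite -(Tl j) kE !ffunE eqxx.
have To l : l != i -> l != j -> Th l (a l) = a l.
  by move=> li lj; rewrite -{2}(Tl l) kE !ffunE (negbTE li) (negbTE lj).
have gi : upd a i (Th i (a i)) \in rho.
  have := hT.2 _ (upd_boxed aB (bB j)) (hb j jE).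
  suff -> : vapply Th (upd a j (b j)) = upd a i (Th i (a i)) by [].
  apply/ffunP=> l; rewrite !ffunE; case: (l =P j) => [->|/eqP lj].
    by rewrite eq_sym (negbTE ij).
  by case: eqP => [->|/eqP li] //; apply: To.
have gj : upd a j (Th j (a j)) \in rho.
  have := hT.2 _ (upd_boxed aB (bB i)) (hb i iE).
  suff -> : vapply Th (upd a i (b i)) = upd a j (Th j (a j)) by [].
  apply/ffunP=> l; rewrite !ffunE; case: (l =P i) => [->|/eqP li].
    by rewrite (negbTE ij).
  by case: eqP => [->|/eqP lj] //; apply: To.
have bad : vapply Th a \notin rho.
  suff -> : vapply Th a = upd (upd a i (Th i (a i))) j (Th j (a j)) by apply: rectE.
  apply/ffunP=> l; rewrite !ffunE; case: (l =P j) => [->|/eqP lj] //.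
  by case: eqP => [->|/eqP li] //; apply: To.
have [Xi [hX XT _]] := binj_inv hT (core_inj C hT bad).
by exists Xi => //; apply/ffunP=> l; rewrite ffunE -(Tl l) XT.
Qed.

Lemma ret_upd i x : i \in I -> upd a i x \in rho -> upd a i (r i x) \in rho.
Proof.
move=> iI xr; have := core_retP C xr; rewrite vapply_upd.
have -> : vapply r a = a by apply/ffunP=> l; rewrite ffunE ra.
apply=> l lI; rewrite updE; case: eqP => // e.
by move: lI; rewrite e iI.
Qed.

Lemma ret_overwrite b (T : {set 'I_n}) : T \subset I -> overwrite b T \in rho ->
  overwrite (fun i => r i (b i)) T \in rho.
Proof.
move=> TI xr; have := core_retP C xr.
suff -> : vapply r (overwrite b T) = overwrite (fun i => r i (b i)) T.
  apply=> l lI; rewrite ffunE; case: ifP => // lT.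
  by move: lI; rewrite (subsetP TI _ lT).
by apply/ffunP=> l; rewrite !ffunE; case: ifP.
Qed.

Lemma pairsB i j : i != j -> j \notin E -> i \in I -> j \in I ->
  exists ci cj, [/\ ci \in B i, cj \in B j, upd a i ci \in rho,
    upd a j cj \in rho & upd (upd a i ci) j cj \in rho].
Proof.
move=> ij jE iI jI; have [x [y [xr yr xyr]]] := pairs ij jE.
exists (r i x), (r j y); split; try exact: core_ret C _ _; try exact: ret_upd.
have := core_retP C xyr; rewrite !vapply_upd.
have -> : vapply r a = a by apply/ffunP=> l; rewrite ffunE ra.
apply=> l lI; rewrite !updE; case: eqP => [e|_]; first by move: lI; rewrite e jI.
by case: eqP => // e; move: lI; rewrite e iI.
Qed.

Lemma linked_upd_same l x y : y \in B l -> upd a l y \in rho ->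
  linked rho B (upd a l x) (upd a l y).
Proof.
move=> yB yr; apply: (linked1 (l := l)); first by split=> //; apply: upd_boxed.
by move=> i il; rewrite !updE (negbTE il).
Qed.

(** The path goes through [ci] at [i], then both [ci] and [cj], then [cj] alone at [j]. *)
Lemma linked_upd i j x y : i \in I -> j \in I -> y \in B j -> upd a j y \in rho ->
  i != j -> (i \notin E) || (j \notin E) -> linked rho B (upd a i x) (upd a j y).
Proof.
move=> iI jI yB yr ij nE.
have [ci [cj [ciB cjB cir cjr cijr]]] : exists ci cj,
    [/\ ci \in B i, cj \in B j, upd a i ci \in rho,
        upd a j cj \in rho & upd (upd a i ci) j cj \in rho].
  case/orP: nE => [iE|jE]; last exact: pairsB.
  have ji : j != i by rewrite eq_sym.
  have [cj [ci [h1 h2 h3 h4 h5]]] := pairsB ji iE jI iI.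
  by exists ci, cj; split=> //; rewrite updC.
have bi : boxed B (upd a i ci) by apply: upd_boxed.
apply: (linked_trans (y := upd a i ci)); first exact: linked_upd_same.
apply: (linked_trans (y := upd (upd a i ci) j cj)).
  apply: (linked1 (l := j)); first by split=> //; apply: upd_boxed.
  by move=> l lj; rewrite [RHS]updE (negbTE lj).
apply: (linked_trans (y := upd a j cj)); last exact: linked_upd_same.
apply: (linked1 (l := i)); first by split=> //; apply: upd_boxed.
by move=> l li; rewrite !updE (negbTE li).
Qed.

(** The coordinates of [T] other than [l] are restored to [a] one at a time. *)
Lemma linked_overwrite b (l : 'I_n) (T : {set 'I_n}) : (forall i, b i \in B i) ->
    (forall V : {set 'I_n}, l \in V -> V \subset T -> overwrite b V \in rho) -> l \in T ->
  linked rho B (overwrite b T) (upd a l (b l)).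
Proof.
move=> bB; have [k] := ubnP #|T|; elim: k T => // k IH T ltk hV lT.
case: (set_0Vmem (T :\ l)) => [T0|[i]].
  suff -> : T = [set l] by rewrite overwrite1; apply: linked_refl.
  by rewrite -(setD1K lT) T0 setU0.
rewrite !inE => /andP[il iT].
have lTi : l \in T :\ i by rewrite !inE eq_sym il lT.
apply: (linked_trans (y := overwrite b (T :\ i))).
  apply: (linked1 (l := i)); last by move=> j ji; rewrite !ffunE !inE ji.
  split; first exact: overwrite_boxed.
  by apply: hV => //; apply: subD1set.
apply: IH => //.
  by rewrite -ltnS (leq_trans _ ltk) // ltnS [X in _ < X](cardsD1 i) iT.
by move=> V lV VT; apply: hV => //; apply: subset_trans VT (subD1set _ _).
Qed.

Lemma not_collapsible_off l : l \notin I -> ~ collapsible rho B l.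
Proof.
move=> lI [Psi [_ _ ninj]]; apply: ninj => x y.
by rewrite (core_off C lI) !inE => /eqP -> /eqP ->.
Qed.

End InCore.

(** * Induction on the set of active coordinates *)

Section Induction.
Variables (m : nat) (f : ('I_m -> A) -> A).
Hypotheses (akey : is_key_tuple rho a) (fwnu : is_WNU f) (fpres : op_preserves f rho).

(** The two excluded sets are unavoidable: overwriting on [set0] gives [a], and a two-element [E]
    whose coordinates are repaired singly stays outside [rho] by [rectE]. *)
Definition witness (I : {set 'I_n}) (b : 'I_n -> A) := forall T : {set 'I_n},
  T \subset I -> T != set0 -> T != E -> overwrite b T \in rho.

Lemma witness_small (I : {set 'I_n}) : #|I| <= 2 -> exists b, witness I b.
Proof.
rewrite leq_eqVlt => /orP[/cards2P [i [j [ij ->]]]|].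
  have [b [hi hj hij]] : exists b : 'I_n -> A, [/\ upd a i (b i) \in rho,
      upd a j (b j) \in rho &
      [set i; j] != E -> upd (upd a i (b i)) j (b j) \in rho].
    pose b x y l : A := if l == i then x else y.
    have bi x y : b x y i = x by rewrite /b eqxx.
    have bj x y : b x y j = y by rewrite /b eq_sym (negbTE ij).
    case: (boolP (j \in E)) => jE; last first.
      have [x [y [h1 h2 h3]]] := pairs ij jE.
      by exists (b x y); rewrite bi bj.
    case: (boolP (i \in E)) => iE; last first.
      have ji : j != i by rewrite eq_sym.
      have [y [x [h1 h2 h3]]] := pairs ji iE.
      by exists (b x y); rewrite bi bj updC.
    have [x hx] := repair i; have [y hy] := repair j.
    exists (b x y); rewrite bi bj; split=> // /eqP[].
    case: E02 => [E0|[k [l [kl EE]]]]; first by rewrite E0 inE in iE.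
    apply/eqP; rewrite eqEcard EE !cards2 kl ij /= andbT -EE.
    by apply/subsetP=> z; rewrite !inE => /orP[] /eqP ->.
  exists b => T Tij T0 TE.
  case: (boolP (i \in T)) => iT; case: (boolP (j \in T)) => jT.
  - have eT : T = [set i; j].
      apply/eqP; rewrite eqEsubset Tij; apply/subsetP=> z.
      by rewrite !inE => /orP[] /eqP ->.
    suff -> : overwrite b T = upd (upd a i (b i)) j (b j) by apply: hij; rewrite -eT.
    rewrite eT; apply/ffunP=> l; rewrite !ffunE !inE.
    by case: (l =P j) => [->|_]; rewrite ?orbT ?orbF //; case: eqP => [->|].
  - suff -> : T = [set i] by rewrite overwrite1.
    apply/setP=> z; rewrite inE; apply/idP/eqP => [zT|-> //].
    move: (subsetP Tij z zT); rewrite !inE => /orP[/eqP //|/eqP zj].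
    by rewrite zj (negbTE jT) in zT.
  - suff -> : T = [set j] by rewrite overwrite1.
    apply/setP=> z; rewrite inE; apply/idP/eqP => [zT|-> //].
    move: (subsetP Tij z zT); rewrite !inE => /orP[/eqP zi|/eqP //].
    by rewrite zi (negbTE iT) in zT.
  - have [z zT] := set0Pn _ T0.
    by move: (subsetP Tij z zT); rewrite !inE => /orP[] /eqP zE; move: zT;
      rewrite zE ?(negbTE iT) ?(negbTE jT).
rewrite ltnS leq_eqVlt ltnS leqn0 => /orP[/cards1P [i ->]|].
  have [x hx] := repair i; exists (fun=> x) => T Ti T0 _.
  suff -> : T = [set i] by rewrite overwrite1.
  by apply/eqP; move: Ti; rewrite subset1 (negbTE T0) orbF.
rewrite cards_eq0 => /eqP ->; exists a => T; rewrite subset0 => /eqP ->.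
by rewrite eqxx.
Qed.

(** The collapse value [c] extends a witness for [I :\ l]. Before coordinate [l] is overwritten, the
    tuple is in [rho], or it is excluded ([set0] or [E]) and then reachable; [collapsible_val]
    covers both. *)
Lemma witness_collapsible I B r m' (F : 'I_n -> ('I_m' -> A) -> A) l b :
    core rho a I B r F -> l \in I -> collapsible rho B l -> witness (I :\ l) b ->
  exists b', witness I b'.
Proof.
move=> C lI cl hb; have [c cB hc] := collapsible_val C cl.
pose b1 i := r i (b i).
have b1B i : b1 i \in B i by apply: core_ret C _ _.
have aB := core_base C.
have hb1 (T : {set 'I_n}) : T \subset I :\ l -> T != set0 -> T != E -> overwrite b1 T \in rho.
  move=> Tl T0 TE; apply: (ret_overwrite C); last exact: hb.
  by apply: subset_trans Tl (subD1set _ _).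
exists (fun i => if i == l then c else b1 i) => T TI T0 TE.
case: (boolP (l \in T)) => lT; last first.
  rewrite (@eq_overwrite _ b1) => [|i iT]; last first.
    by case: eqP => // e; move: lT; rewrite -e iT.
  by apply: hb1 => //; rewrite subsetD1 TI.
suff -> : overwrite (fun i => if i == l then c else b1 i) T
        = upd (overwrite b1 (T :\ l)) l c.
  apply: hc; first exact: overwrite_boxed.
    by rewrite ffunE !inE eqxx.
  have Tl : T :\ l \subset I :\ l by apply: setSD.
  case: (altP (T :\ l =P set0)) => [->|T0'].
    by right; rewrite overwrite0; apply: reach_base.
  case: (altP (T :\ l =P E)) => [TlE|TE']; last by left; apply: hb1.
  right; rewrite TlE; apply: (reach_overwriteE C) => // i iE.
  rewrite -overwrite1; apply: hb1; first by rewrite sub1set (subsetP Tl) ?TlE.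
    by rewrite -cards_eq0 cards1.
  exact: set1_neqE.
apply/ffunP=> i; rewrite !ffunE !inE; case: eqP => [->|] //=.
by rewrite lT.
Qed.

(* Adding a coordinate to [E] or to the empty set creates the only arguments outside [rho];
   they sit on one of three argument sets on which no polynomial is bijective. *)
Lemma witness_rigid I B r m' (F : 'I_n -> ('I_m' -> A) -> A) :
    core rho a I B r F -> 2 < #|I| -> (forall l, ~ collapsible rho B l) ->
    (forall l, l \in I -> exists b, witness (I :\ l) b) ->
  exists b, witness I b.
Proof.
move=> C I3 nc IH; have aB := core_base C.
(* [bb l] solves the problem for [I :\ l] and equals [a] at [l], so overwriting by it on [T] only
   sees [T :\ l]. *)
have [bb hbb] : exists bb : 'I_n -> 'I_n -> A, forall l, l \in I ->
   [/\ forall i, bb l i \in B i, bb l l = a l & forall T : {set 'I_n}, T \subset I ->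
       T :\ l != set0 -> T :\ l != E -> overwrite (bb l) T \in rho].
  apply: (fin_all_exists (P := fun l (b : 'I_n -> A) => l \in I ->
    [/\ forall i, b i \in B i, b l = a l & forall T : {set 'I_n}, T \subset I ->
       T :\ l != set0 -> T :\ l != E -> overwrite b T \in rho])) => l.
  case: (boolP (l \in I)) => [lI|_]; last by exists a.
  have [b hb] := IH l lI.
  exists (fun i => if i == l then a l else r i (b i)) => _; split.
  - by move=> i; case: eqP => [->|_] //; apply: core_ret C _ _.
  - by rewrite eqxx.
  move=> T TI T0 TE; rewrite (@overwriteD1 _ l) ?eqxx //.
  rewrite (@eq_overwrite _ (fun i => r i (b i))); last first.
    by move=> i; rewrite !inE => /andP[/negbTE ->].
  apply: (ret_overwrite C); first by apply: subset_trans TI; apply: subD1set.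
  by apply: hb => //; apply: setSD.
have /card_gt2P [l1 [l2 [l3 [[l1I l2I l3I] [l12 l23 l31]]]]] := I3.
have [j jI jE] : exists2 j, j \in I & j \notin E.
  apply/subsetPn; apply/negP=> /subset_leq_card IE.
  have: 2 < #|E| by apply: leq_trans IE.
  by case: E02 => [->|[i [j [ij ->]]]]; rewrite ?cards0 ?cards2 ?ij.
have [i iI ij] : exists2 i, i \in I & i != j.
  by case: (altP (l1 =P j)) => [<-|?]; [exists l2; rewrite // eq_sym|exists l1].
have [ci [cj [ciB cjB cir cjr cijr]]] := pairsB C ij jE iI jI.
pose t := upd a i ci.
have tg : good rho B t by split=> //; apply: upd_boxed.
have lt l x : l \in I -> linked rho B (upd a l x) t.
  move=> lI; case: (altP (l =P i)) => [->|li]; first exact: (linked_upd_same C).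
  case: (boolP (l \in E)) => lE; last by apply: (linked_upd C); rewrite ?lE.
  have lj : l != j by apply/eqP=> e; rewrite e (negbTE jE) in lE.
  apply: (linked_trans (y := upd a j cj)).
    by apply: (linked_upd C); rewrite ?jE ?orbT.
  by apply: (linked_upd C); rewrite ?jE // eq_sym.
pose P S := binj B (fpoly F S (fun _ => t)).
have PT : P setT.
  by move=> l x y xB yB; rewrite !(fpoly_fix C) // => k; rewrite inE.
(* For [p0] in a minimal [S], the sets [[set p0]], [S :\ p0] and [~: S] partition the arguments, and
   [P] fails on each: by [single_not_binj], by minimality, and by [not_both_binj]. *)
have [S [PS Smin]] := ex_measure_min (fun S : {set 'I_m'} => #|S|) (ex_intro P _ PT).
have P1 p : ~ P [set p] by apply: (single_not_binj C ij ciB cjB).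
have [p0 p0S] : exists p, p \in S.
  apply/set0Pn/eqP => S0; have := PS i ci (a i) ciB (aB i).
  rewrite S0 /fpoly => e; have: ci = a i.
    by apply: e; congr (F i _); apply: functional_extensionality => k; rewrite inE.
  by move=> e'; move: cir; rewrite e' upd_id (negbTE (core_bad C)).
have PSp : ~ P (S :\ p0).
  by move=> /Smin; rewrite (cardsD1 p0 S) p0S ltnn.
have PSC : ~ P (~: S).
  by apply: (not_both_binj C ij ciB cjB) PS => //; rewrite -setI_eq0 setICr.
pose la p := if p == p0 then l1 else if p \in S then l2 else l3.
have laI p : la p \in I by rewrite /la; case: ifP => // _; case: ifP.
have Pla p : ~ P [set q | la q == la p].
  have n21 : (l2 == l1) = false by rewrite eq_sym (negbTE l12).
  have n32 : (l3 == l2) = false by rewrite eq_sym (negbTE l23).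
  have n13 : (l1 == l3) = false by rewrite eq_sym (negbTE l31).
  have n12 := negbTE l12; have n23 := negbTE l23; have n31 := negbTE l31.
  rewrite {2}/la; case: ifP => _; last case: ifP => _.
  - suff -> : [set q | la q == l1] = [set p0] by [].
    apply/setP=> q; rewrite !inE /la; case: (q == p0); rewrite ?eqxx //.
    by case: ifP; rewrite ?n21 ?n31.
  - suff -> : [set q | la q == l2] = S :\ p0 by [].
    apply/setP=> q; rewrite !inE /la; case: (q == p0); rewrite ?n12 //.
    by case: ifP; rewrite ?eqxx ?n32.
  - suff -> : [set q | la q == l3] = ~: S by [].
    apply/setP=> q; rewrite !inE /la; case: (q =P p0) => [->|_]; rewrite ?n13 ?p0S //.
    by case: ifP; rewrite ?eqxx ?n23.
(* Each argument of [F] receives the witness of the subproblem that omits the coordinate labelling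
   its block. *)
exists (fun i => F i (fun p => bb (la p) i)) => T TI T0 TE.
pose U p := overwrite (bb (la p)) T.
have -> : overwrite (fun i => F i (fun p => bb (la p) i)) T
        = [ffun i => F i (fun p => U p i)].
  apply/ffunP=> l; rewrite !ffunE; case: ifP => lT.
    by congr (F l _); apply: functional_extensionality => p; rewrite ffunE lT.
  rewrite -[LHS](core_idem C (aB l)); congr (F l _).
  by apply: functional_extensionality => p; rewrite ffunE lT.
have bbB p i' : bb (la p) i' \in B i' by case: (hbb _ (laI p)).
have UB p : boxed B (U p) by apply: overwrite_boxed.
have Ug p : T :\ la p != set0 -> T :\ la p != E -> good rho B (U p).
  by move=> h0 hE; split=> //; case: (hbb _ (laI p)) => _ _; apply.
case: (classic (exists p, T :\ la p = set0 \/ T :\ la p = E)) => [[p hp]|no]; last first.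
  apply: (good_F C _).2 => p; apply: Ug; apply/eqP => e; apply: no; exists p; tauto.
pose l := la p.
have lT : l \in T.
  apply/negPn/negP=> lT; have e : T :\ l = T by apply/setDidPl; rewrite disjoint_sym disjoints1.
  by move: hp T0 TE; rewrite -/l e => -[] ->; rewrite eqxx.
have TlE : l \in E -> T = [set l].
  move=> lE; case: hp => [h|h]; last by move: lE; rewrite -h !inE eqxx.
  by rewrite -(setD1K lT) h setU0.
(* Arguments in the other two blocks are safe: [V :\ la q] still contains [l], and if it were [E],
   then [T] would be [[set l]] and [E] a singleton. *)
have sub_ok q (V : {set 'I_n}) : la q != l -> l \in V -> V \subset T ->
    V :\ la q != set0 /\ V :\ la q != E.
  move=> ql lV VT; have lVq : l \in V :\ la q by rewrite !inE eq_sym ql.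
  split; first by apply/set0Pn; exists l.
  apply/eqP=> e; have lE : l \in E by rewrite -e.
  have VE : V = [set l].
    apply/eqP; rewrite eqEsubset sub1set lV andbT -(TlE lE) //.
  have : V :\ la q = [set l].
    apply/eqP; rewrite eqEsubset sub1set lVq andbT VE; exact: subD1set.
  by rewrite e => e'; move: (set1_neqE l); rewrite -e' eqxx.
have kr : reach rho a B (U p).
  have [_ bl ho] := hbb _ (laI p).
  rewrite /U (overwriteD1 _ bl); case: hp => [->|h].
    by rewrite overwrite0; apply: reach_base.
  rewrite h; apply: (reach_overwriteE C) => // i' i'E.
  have i'T : i' \in T :\ l by rewrite /l h.
  have i'l : i' != l by move: i'T; rewrite !inE => /andP[].
  have e1 : [set i'] :\ l = [set i'].
    by apply/setDidPl; rewrite disjoints1 inE.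
  rewrite -overwrite1; apply: ho; rewrite -/l ?e1 ?set1_neqE //.
    by rewrite sub1set (subsetP TI) //; move: i'T; rewrite !inE => /andP[].
  by rewrite -cards_eq0 cards1.
(* The block [Q] receives the same reachable tuple [U p] throughout, the rest good tuples linked to
   [t]. A result outside [rho] would make the polynomial on [Q] bijective, and moving its frozen
   arguments to [t] would contradict [Pla]. *)
pose Q := [set q | la q == l].
have offQ q : q \notin Q -> good rho B (U q) /\ linked rho B (U q) t.
  rewrite inE => ql; split.
    by have [h0 hE] := sub_ok q T ql lT (subxx _); apply: Ug.
  have [qB _ ho] := hbb _ (laI q).
  apply: (linked_trans (y := upd a l (bb (la q) l))); last by apply: lt; apply: laI.
  apply: (linked_overwrite C) => // V lV VT.
  have [h0 hE] := sub_ok q V ql lV VT; apply: ho => //.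
  exact: subset_trans VT TI.
have -> : [ffun i => F i (fun p => U p i)] = vapply (fpoly F Q U) (U p).
  rewrite vapply_fpoly; apply/ffunP=> i'; rewrite !ffunE; congr (F i' _).
  apply: functional_extensionality => q; case: ifP => //.
  by rewrite inE => /eqP e; rewrite /U e.
have hQ : bmap rho B (fpoly F Q U) by apply: (fpoly_bmap C) => q /offQ [].
apply/negPn/negP=> bad; apply: (Pla p).
apply: (binj_fpoly_linked C nc tg offQ).
exact: reach_binj C _ _ kr hQ bad.
Qed.

Lemma witness_exists (I : {set 'I_n}) : exists b, witness I b.
Proof.
have [k] := ubnP #|I|; elim: k I => // k IH I ltk.
case: (leqP #|I| 2) => [|I3]; first exact: witness_small.
have IHD l : l \in I -> exists b, witness (I :\ l) b.
  move=> lI; apply: IH; rewrite -ltnS (leq_trans _ ltk) // ltnS.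
  by rewrite [X in _ < X](cardsD1 l) lI.
have [B [r [F C]]] := core_exists I akey fwnu fpres.
case: (classic (exists l, collapsible rho B l)) => [[l cl]|nc].
  have lI : l \in I by apply/negPn/negP=> lI; apply: (not_collapsible_off C lI cl).
  have [b hb] := IHD l lI; exact: witness_collapsible C lI cl hb.
by apply: (witness_rigid C I3 _ IHD) => l cl; apply: nc; exists l.
Qed.

End Induction.

End Disjunctions.

(** * Linear structure on a class with at least three elements *)

Definition plug (A : finType) (n : nat) (K : {set 'I_n}) (a : {ffun 'I_n -> A})
    (p : nat) (w : 'I_n -> 'Z_p -> A) (z : 'I_n -> 'Z_p) : {ffun 'I_n -> A} :=
  [ffun l => if l \in K then w l (z l) else a l].

(** A translation moves [i0] together with one other coordinate by the same amount, so the invariant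
    is the coordinate at [i0] minus the sum of the others. *)
Definition sgn (n p : nat) (i0 l : 'I_n) : 'Z_p := (if l == i0 then 1 else -1)%R.
Arguments sgn {n p} i0 l.

Lemma sgn_sq n p (i0 j : 'I_n) : (sgn i0 j * sgn i0 j = 1 :> 'Z_p)%R.
Proof. by rewrite /sgn; case: eqP => _; rewrite ?mulr1 // mulrNN mulr1. Qed.

Section LinearClass.
Variables (A : finType) (n : nat) (rho : {set {ffun 'I_n -> A}}).
Variables (a : {ffun 'I_n -> A}) (I : {set 'I_n}) (B : 'I_n -> {set A}).
Variables (r : 'I_n -> A -> A) (m : nat) (F : 'I_n -> ('I_m -> A) -> A).
Hypothesis C : core rho a I B r F.
Notation tup := {ffun 'I_n -> A}.
Variable K : {set 'I_n}.
Hypothesis rectK : forall i j (c : tup) x y, i \in K -> j \in K -> i != j ->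
  upd c i x \in rho -> upd c j y \in rho -> upd (upd c i x) j y \in rho -> c \in rho.
Variable b : 'I_n -> A.
Hypothesis bB : forall i, i \in K -> b i \in B i.
Hypothesis bgood : forall i, i \in K -> upd a i (b i) \in rho.

Let aB : boxed B a := core_base C.

Lemma class_third i j : 2 < #|K| -> exists2 k, k \in K & (k != i) && (k != j).
Proof.
move=> K3; have : 0 < #|K :\ i :\ j|.
  have h1 := cardsD1 i K; have h2 := cardsD1 j (K :\ i).
  move: K3; rewrite h1 h2; case: (i \in K); case: (j \in K :\ i); case: #|_|; by [].
rewrite card_gt0 => /set0Pn [k]; rewrite !inE => /and3P[kj ki kK].
by exists k; rewrite // ki.
Qed.

(* The sets [S] such that overwriting by [w (~: S)] repairs [a] would be closed under
   adding points, by rectangularity in three coordinates, and would reach the full set. *)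
Lemma class_single i c p : 2 < #|K| -> i \in K -> c \in B i -> upd a i c \in rho ->
  vapply (fpoly F [set p] (fun _ => upd a i c)) a \notin rho.
Proof.
move=> K3 iK cB cr; apply/negP=> good1.
have [i1 i1K] := class_third i i K3; rewrite andbb => i1i.
have [i2 i2K /andP[i2i i2i1]] := class_third i i1 K3.
pose V x y z := upd (upd (upd a i1 x) i2 y) i z.
have ni1 := negbTE i1i; have ni2 := negbTE i2i; have n12 := negbTE i2i1.
have ni1' : (i == i1) = false by rewrite eq_sym.
have ni2' : (i == i2) = false by rewrite eq_sym.
have n12' : (i1 == i2) = false by rewrite eq_sym.
have VE x y z l : V x y z l = if l == i then z else if l == i2 then y else
    if l == i1 then x else a l by rewrite !ffunE.
have V0 z : V (a i1) (a i2) z = upd a i z.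
  apply/ffunP=> l; rewrite VE ffunE; case: (l == i) => //.
  by case: eqP => [->|_] //; case: eqP => [->|].
have rect12 x x' y y' z : V x y z \in rho -> V x' y z \in rho -> V x y' z \in rho ->
    V x' y' z \in rho.
  move=> h h1 h2; apply: (rectK (i := i1) (j := i2) (x := x) (y := y)); rewrite ?n12' //.
  - suff -> : upd (V x' y' z) i1 x = V x y' z by [].
    apply/ffunP=> l; rewrite ffunE !VE; case: (l =P i1) => [->|] //.
    by rewrite ni1 n12'.
  - suff -> : upd (V x' y' z) i2 y = V x' y z by [].
    by apply/ffunP=> l; rewrite ffunE !VE; case: (l =P i2) => [->|] //; rewrite ni2.
  - suff -> : upd (upd (V x' y' z) i1 x) i2 y = V x y z by [].
    apply/ffunP=> l; rewrite !(ffunE, VE).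
    case: (l =P i2) => [->|_]; first by rewrite ni2.
    by case: (l =P i1) => [->|] //; rewrite ni1.
have rect23 x y y' z z' : V x y z \in rho -> V x y' z \in rho -> V x y z' \in rho ->
    V x y' z' \in rho.
  move=> h h1 h2; apply: (rectK (i := i2) (j := i) (x := y) (y := z)); rewrite ?ni2 //.
  - suff -> : upd (V x y' z') i2 y = V x y z' by [].
    by apply/ffunP=> l; rewrite ffunE !VE; case: (l =P i2) => [->|] //; rewrite ni2.
  - suff -> : upd (V x y' z') i z = V x y' z by [].
    by apply/ffunP=> l; rewrite ffunE !VE; case: (l =P i).
  - suff -> : upd (upd (V x y' z') i2 y) i z = V x y z by [].
    apply/ffunP=> l; rewrite !(ffunE, VE); case: (l =P i) => // _.
    by case: (l =P i2).
have rect13 x x' y z z' : V x y z \in rho -> V x' y z \in rho -> V x y z' \in rho ->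
    V x' y z' \in rho.
  move=> h h1 h2; apply: (rectK (i := i1) (j := i) (x := x) (y := z)); rewrite ?ni1 //.
  - suff -> : upd (V x' y z') i1 x = V x y z' by [].
    apply/ffunP=> l; rewrite ffunE !VE; case: (l =P i1) => [->|] //.
    by rewrite ni1 n12'.
  - suff -> : upd (V x' y z') i z = V x' y z by [].
    by apply/ffunP=> l; rewrite ffunE !VE; case: (l =P i).
  - suff -> : upd (upd (V x' y z') i1 x) i z = V x y z by [].
    apply/ffunP=> l; rewrite !(ffunE, VE); case: (l =P i) => // _.
    by case: (l =P i1) => [->|//]; rewrite n12'.
pose g l x (S : {set 'I_m}) := F l (fun k => if k \in S then x else a l).
pose u := g i1 (b i1); pose v := g i2 (b i2); pose w := g i c.
have g0 l x : g l x set0 = a l.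
  rewrite -[RHS](core_idem C (aB l)); congr (F l _).
  by apply: functional_extensionality => k; rewrite inE.
have part (S1 S2 : {set 'I_m}) : [disjoint S1 & S2] ->
    V (u S1) (v S2) (w (~: (S1 :|: S2))) \in rho.
  move=> dis.
  pose T k := if k \in S1 then upd a i1 (b i1) else if k \in S2 then upd a i2 (b i2)
              else upd a i c.
  have : good rho B [ffun l => F l (fun k => T k l)].
    apply: (good_F C) => k; rewrite /T.
    by case: ifP => _; last case: ifP => _; split;
      do ?[exact: bgood|exact: cr|apply: upd_boxed]; rewrite ?bB.
  case=> _; suff -> : [ffun l => F l (fun k => T k l)]
        = V (u S1) (v S2) (w (~: (S1 :|: S2))) by [].
  apply/ffunP=> l; rewrite VE ffunE /u /v /w /g /T.
  case: (l =P i) => [->|/eqP/negbTE li].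
    congr (F i _); apply: functional_extensionality => k; rewrite !inE.
    by case: (k \in S1); last case: (k \in S2); rewrite /= !ffunE ?ni1' ?ni2' ?eqxx.
  case: (l =P i2) => [->|/eqP/negbTE li2].
    congr (F i2 _); apply: functional_extensionality => k.
    case: ifP => kS1; first by rewrite (disjointFr dis kS1) ffunE n12.
    by case: ifP; rewrite ffunE ?eqxx ?ni2.
  case: (l =P i1) => [->|/eqP/negbTE li1].
    congr (F i1 _); apply: functional_extensionality => k.
    by case: ifP => // _; [rewrite ffunE eqxx|case: ifP; rewrite ffunE ?n12' ?ni1].
  rewrite -[RHS](core_idem C (aB l)); congr (F l _); apply: functional_extensionality => k.
  by case: ifP => _; last case: ifP => _; rewrite ffunE ?li1 ?li2 ?li.
(* The WNU identity carries the assumption [good1] from [p] to every argument [q]. *)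
have wsingle q : upd a i (w (~: [set q])) \in rho.
  suff <- : vapply (fpoly F [set p] (fun _ => upd a i c)) a = upd a i (w (~: [set q])).
    by [].
  apply/ffunP=> l; rewrite !ffunE /fpoly; case: (l =P i) => [->|/eqP/negbTE li].
    rewrite /w /g.
    transitivity (F i (fun k => if k == p then a i else c)).
      congr (F i _); apply: functional_extensionality => k.
      by rewrite inE ffunE eqxx.
    rewrite (core_wnu C _ _ _ p q); congr (F i _).
    by apply: functional_extensionality => k; rewrite !inE; case: eqP.
  rewrite -[RHS](core_idem C (aB l)); congr (F l _); apply: functional_extensionality => k.
  by case: ifP => // _; rewrite ffunE li.
have wall (S : {set 'I_m}) : S != set0 -> upd a i (w (~: S)) \in rho.
  have [k] := ubnP #|S|; elim: k S => // k IH S ltk /set0Pn [q qS].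
  case: (altP (S :\ q =P set0)) => [S0|S0].
    by rewrite -(setD1K qS) S0 setU0.
  have dis : [disjoint S :\ q & [set q]].
    by rewrite disjoint_sym disjoints1 !inE eqxx.
  have h1 : upd a i (w (~: (S :\ q))) \in rho.
    apply: IH => //; rewrite -ltnS (leq_trans _ ltk) // ltnS.
    by rewrite [X in _ < X](cardsD1 q) qS.
  have h2 := wsingle q.
  (* [S :\ q] is charged to [i1] and [q] to [i2]; the four rectangles below then restore [i1] and
     [i2] to [a] while keeping [w (~: S)] at [i]. *)
  have h3 := part _ _ dis; rewrite setUC setD1K // in h3.
  have d0 (S' : {set 'I_m}) : [disjoint S' & set0] by rewrite -setI_eq0 setI0.
  have h4 := part _ _ (d0 (S :\ q)); rewrite setU0 /v g0 in h4.
  have h5 : V (a i1) (v [set q]) (w (~: [set q])) \in rho.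
    have dq : [disjoint set0 & [set q]] by rewrite disjoint_sym.
    by have := part _ _ dq; rewrite set0U /u g0.
  rewrite -!V0 in h1 h2 *.
  have h6 := rect23 _ _ _ _ _ h2 h5 h1.
  have h7 := rect12 _ _ _ _ _ h1 h4 h6.
  have h8 := rect23 _ _ _ _ _ h7 h4 h3.
  exact: rect13 h4 h1 h8.
have : upd a i (w (~: setT)) \in rho.
  by apply: wall; rewrite -cards_eq0 cardsT card_ord -lt0n (ltnW (core_arity C)).
by rewrite setCT /w g0 upd_id (negbTE (core_bad C)).
Qed.

(** [class_single] and rigidity make the one-argument polynomial bijective, which [single_not_binj]
    forbids unless [j] collapses. *)
Lemma class_collapsible j ci cj i : 2 < #|K| -> i \in K -> i != j ->
    ci \in B i -> cj \in B j -> upd a i ci \in rho -> upd a j cj \in rho ->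
    upd (upd a i ci) j cj \in rho -> collapsible rho B j.
Proof.
move=> K3 iK ij ciB cjB cir cjr cijr; apply: NNPP => nc.
pose p := Ordinal (core_arity C).
apply: (single_not_binj C ij ciB cjB cir cjr cijr nc (p := p)).
apply: core_inj C _ _ _; last exact: class_single.
by apply: (fpoly_bmap C) => k _; split=> //; apply: upd_boxed.
Qed.

(** * An addition from the WNU, and its translations *)

Section Addition.
Variable i0 : 'I_n.
Hypotheses (i0K : i0 \in K) (K3 : 2 < #|K|).

Definition origin : tup := upd a i0 (b i0).

Lemma origin_good : good rho B origin.
Proof. by split; [apply: upd_boxed; [exact: aB|exact: bB]|exact: bgood]. Qed.

Lemma originE l : l != i0 -> origin l = a l.
Proof. by move=> li; rewrite updE (negbTE li). Qed.

(** The polynomial in one argument with the others frozen at [origin] is bijective by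
    [class_single]; composing the two-argument polynomial with its inverse makes [origin] a right
    unit, and a left unit by the WNU identity. *)
Lemma class_add : exists add : 'I_n -> A -> A -> A,
  [/\ forall l x y, x \in B l -> y \in B l -> add l x y \in B l,
      forall x y, good rho B x -> good rho B y -> good rho B [ffun l => add l (x l) (y l)],
      forall l x, x \in B l -> add l x (origin l) = x &
      forall l x, x \in B l -> add l (origin l) x = x].
Proof.
have m1 := core_arity C; pose p0 := Ordinal (ltnW m1); pose p1 := Ordinal m1.
have og := origin_good.
have hh : bmap rho B (fpoly F [set p0] (fun _ => origin)) by apply: (fpoly_bmap C).
have hbad := class_single p0 K3 i0K (bB i0K) (bgood i0K).
have [h' [hh' h'h _]] := binj_inv hh (core_inj C hh hbad).
exists (fun l x y => h' l (F l (fun k => if k == p0 then x else if k == p1 then y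
                                         else origin l))); split.
- by move=> l x y _ _; apply: hh'.1; apply: core_FB C _ _.
- move=> x y xg yg.
  pose T k := if k == p0 then x else if k == p1 then y else origin.
  have [TB Tr] : good rho B [ffun l => F l (fun k => T k l)].
    by apply: (good_F C) => k; rewrite /T; case: ifP => // _; case: ifP.
  suff -> : [ffun l => h' l (F l (fun k => if k == p0 then x l else
      if k == p1 then y l else origin l))] = vapply h' [ffun l => F l (fun k => T k l)].
    by split; [apply: vapply_boxed hh' TB|apply: hh'.2].
  apply/ffunP=> l; rewrite [LHS]ffunE [RHS]ffunE; congr (h' l _).
  rewrite [RHS]ffunE; congr (F l _).
  by apply: functional_extensionality => k; rewrite /T; case: ifP => // _; case: ifP.
- move=> l x xB; rewrite -[RHS](h'h l x xB); congr (h' l _); rewrite /fpoly.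
  congr (F l _); apply: functional_extensionality => k; rewrite inE.
  by case: ifP => // _; case: ifP.
- move=> l x xB; rewrite -[RHS](h'h l x xB); congr (h' l _); rewrite /fpoly.
  transitivity (F l (fun k => if k == p1 then x else origin l)).
    congr (F l _); apply: functional_extensionality => k.
    by case: (k =P p0) => [->|].
  rewrite (core_wnu C _ _ _ p1 p0); congr (F l _).
  by apply: functional_extensionality => k; rewrite inE.
Qed.

Variable add : 'I_n -> A -> A -> A.
Hypothesis addB : forall l x y, x \in B l -> y \in B l -> add l x y \in B l.
Hypothesis addP : forall x y, good rho B x -> good rho B y ->
  good rho B [ffun l => add l (x l) (y l)].
Hypothesis addo : forall l x, x \in B l -> add l x (origin l) = x.
Hypothesis oadd : forall l x, x \in B l -> add l (origin l) x = x.

(** Since [origin] is [b i0] at [i0] and [a l] elsewhere, the summand is the other one of the two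
    values in each case. *)
Definition shift l x := add l x (if l == i0 then a i0 else b l).

(** For [k != i0] the added tuple differs from the unit [origin] only at [i0] and [k], so only these
    two coordinates are shifted. *)
Definition translate k l x := add l x (upd a k (b k) l).

Let tgood k : k \in K -> good rho B (upd a k (b k)).
Proof. by move=> kK; split; [apply: upd_boxed; [exact: aB|exact: bB]|exact: bgood]. Qed.

Lemma translate_bmap k : k \in K -> bmap rho B (translate k).
Proof.
move=> kK; have tg := tgood kK; split=> [l x xB|x xB xr].
  by apply: addB => //; apply: tg.1.
have [_] := addP (conj xB xr) tg.
suff -> : [ffun l => add l (x l) (upd a k (b k) l)] = vapply (translate k) x by [].
by apply/ffunP=> l; rewrite [LHS]ffunE [RHS]ffunE.
Qed.

Lemma translateE k l x : k != i0 -> x \in B l ->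
  translate k l x = if (l == i0) || (l == k) then shift l x else x.
Proof.
move=> ki xB; rewrite /translate /shift updE.
case: (l =P i0) => [->|/eqP li] /=; first by rewrite eq_sym (negbTE ki).
by case: eqP => [->|_] //; rewrite -(originE li) addo.
Qed.

(** By rigidity it suffices that the image of [a] is outside [rho]. Otherwise rectangularity at [i0]
    and a third element [k'] repairs [a] by [b k] and [b k'] together, and rectangularity at [k],
    [k'] then puts [a] into [rho]. *)
Lemma translate_binj k : k \in K -> k != i0 -> binj B (translate k).
Proof.
move=> kK ki; have hT := translate_bmap kK; apply: core_inj C _ hT _; apply/negP=> gd.
have [k' k'K /andP[k'i k'k]] := class_third i0 k K3.
pose g2 := add i0 (a i0) (a i0).
have nki := negbTE ki; have nk'i := negbTE k'i; have nk'k := negbTE k'k.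
have nik : (i0 == k) = false by rewrite eq_sym.
have nik' : (i0 == k') = false by rewrite eq_sym.
have nkk' : (k == k') = false by rewrite eq_sym.
have akB l : a l \in B l by exact: aB.
have sk l : l != i0 -> add l (a l) (b l) = if l \in K then b l else add l (a l) (b l).
  by move=> li; case: ifP => // lK; rewrite -{1}(originE li) oadd // bB.
pose d1 := upd (upd a k (b k)) i0 g2.
have d1E : vapply (translate k) a = d1.
  apply/ffunP=> l; rewrite ffunE translateE ?akB // !ffunE /shift.
  case: (l =P i0) => [->|/eqP li] //=.
  by case: eqP => [->|//]; rewrite sk ?kK.
have d2r : upd d1 k' (b k') \in rho.
  have [_] := addP (tgood kK) (tgood k'K).
  suff -> : [ffun l => add l (upd a k (b k) l) (upd a k' (b k') l)] = upd d1 k' (b k') by [].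
  apply/ffunP=> l; rewrite !ffunE.
  case: (l =P k') => [->|_]; first by rewrite nk'k sk ?k'K.
  case: (l =P i0) => [->|/eqP li]; first by rewrite nik.
  by rewrite -(originE li) addo ?originE //; case: eqP => [->|]; rewrite ?bB.
have cr : upd (upd a k (b k)) k' (b k') \in rho.
  apply: (rectK (i := i0) (j := k') (x := g2) (y := a k')); rewrite ?nik' //.
  - suff -> : upd (upd (upd a k (b k)) k' (b k')) i0 g2 = upd d1 k' (b k') by [].
    by rewrite updC // eq_sym nik'.
  - suff -> : upd (upd (upd a k (b k)) k' (b k')) k' (a k') = upd a k (b k) by exact: bgood.
    by apply/ffunP=> l; rewrite !ffunE; case: (l =P k') => [->|] //; rewrite nk'k.
  - suff -> : upd (upd (upd (upd a k (b k)) k' (b k')) i0 g2) k' (a k') = d1 by rewrite -d1E.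
    apply/ffunP=> l; rewrite !ffunE; case: (l =P k') => [->|] //.
    by rewrite nk'i nk'k.
have := core_bad C; apply/negP/negPn.
by apply: (rectK kK k'K _ (bgood kK) (bgood k'K) cr); rewrite nkk'.
Qed.

Lemma shiftB l x : l \in K -> x \in B l -> shift l x \in B l.
Proof. by move=> lK xB; apply: addB => //; case: eqP => [->|_]; [apply: aB|apply: bB]. Qed.

Lemma shift_inj l : l \in K -> {in B l &, injective (shift l)}.
Proof.
move=> lK; have [k kK /andP[ki kl]] := class_third i0 l K3.
case: (altP (l =P i0)) => [->|li].
  apply: (eq_in_inj (f := translate k i0)); last exact: translate_binj.
  by move=> x xB; rewrite translateE // eqxx.
apply: (eq_in_inj (f := translate l l)); last exact: translate_binj.
by move=> x xB; rewrite translateE // eqxx orbT.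
Qed.

Lemma shift_order : exists N, forall l x, l \in K -> x \in B l -> iter N.+1 (shift l) x = x.
Proof.
pose Sg l := if l \in K then shift l else id.
have [l x xB|l|N hN] := @iter_binj_id A n B Sg.
- by rewrite /Sg; case: ifP => // lK; apply: shiftB.
- rewrite /Sg; case: ifP => [lK|_ x y _ _ //] x y xB yB.
  exact: (shift_inj lK xB yB).
by exists N => l x lK xB; rewrite -[RHS](hN l x xB) /Sg lK.
Qed.

Definition point (L : 'I_n -> nat) : tup :=
  [ffun l => if l \in K then iter (L l) (shift l) (origin l) else a l].

Lemma pointE L l :
  point L l = if l \in K then iter (L l) (shift l) (origin l) else a l.
Proof. exact: ffunE. Qed.

Lemma iter_shiftB l s : l \in K -> iter s (shift l) (origin l) \in B l.
Proof.
move=> lK; elim: s => [|s IH]; last exact: shiftB.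
exact: origin_good.1.
Qed.

Lemma point_boxed L : boxed B (point L).
Proof. by move=> l; rewrite ffunE; case: ifP => [/iter_shiftB|_]; [apply|apply: aB]. Qed.

Lemma translate_point k L s : k \in K -> k != i0 ->
  iter s (vapply (translate k)) (point L)
  = point (fun l => L l + s * ((l == i0) || (l == k))).
Proof.
move=> kK ki; elim: s => [|s IH].
  by apply/ffunP=> l; rewrite !ffunE mul0n addn0.
rewrite iterS IH; apply/ffunP=> l; rewrite ffunE translateE ?point_boxed // !ffunE.
case: (boolP ((l == i0) || (l == k))) => [/orP h|_] /=; last by rewrite !muln0.
have lK : l \in K by case: h => /eqP ->.
by rewrite lK !muln1 addnS.
Qed.

Lemma translate_point_rho k L s : k \in K -> k != i0 ->
  (point (fun l => L l + s * ((l == i0) || (l == k))) \in rho) = (point L \in rho).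
Proof.
move=> kK ki; rewrite -translate_point //; elim: s => // s; rewrite iterS => <-.
have hT := translate_bmap kK; have inj := translate_binj kK ki.
have bx : boxed B (iter s (vapply (translate k)) (point L)).
  by rewrite translate_point //; apply: point_boxed.
by apply/idP/idP => [|h]; [apply: binj_bad hT inj bx|apply: hT.2].
Qed.

(** The map [x |-> (..(origin + x) + ..) + x] with [d] summands [x] preserves [rho]; at [x = a] it
    iterates the shift at [i0] and adds the unit elsewhere. *)
Lemma point_reach_single d : reach rho a B (point (fun l => if l == i0 then d else 0)).
Proof.
pose Om e l x := iter e (fun y => add l y x) (origin l).
have OmB e l x : x \in B l -> Om e l x \in B l.
  by move=> xB; elim: e => [|e IH]; [apply: origin_good.1|apply: addB].
have OmP e x : good rho B x -> good rho B (vapply (Om e) x).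
  move=> xg; elim: e => [|e IH].
    suff -> : vapply (Om 0) x = origin by exact: origin_good.
    by apply/ffunP=> l; rewrite ffunE.
  have := addP IH xg; congr (good rho B _).
  by apply/ffunP=> l; rewrite !ffunE.
exists (Om d).
  by split=> [l x|x xB xr]; [exact: OmB|case: (OmP d x (conj xB xr))].
apply/ffunP=> l; rewrite !ffunE /Om.
case: (l =P i0) => [->|/eqP li]; first by rewrite i0K /shift /origin updE eqxx.
have -> : iter d (fun y => add l y (a l)) (origin l) = origin l.
  elim: d => //= e ->; rewrite -(originE li) addo //.
  exact: origin_good.1.
by rewrite originE //; case: ifP.
Qed.

(** * Exponents modulo the order [N.+1] of the shifts *)

Variable N : nat.
Hypothesis shiftN : forall l x, l \in K -> x \in B l -> iter N.+1 (shift l) x = x.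

Lemma eq_point_mod L L' : (forall l, l \in K -> L l = L' l %[mod N.+1]) ->
  point L = point L'.
Proof.
move=> e; apply/ffunP=> l; rewrite [LHS]ffunE [RHS]ffunE; case: ifP => // lK.
have it q : iter (q * N.+1) (shift l) (origin l) = origin l.
  elim: q => [//|q IH]; rewrite mulSn iterD IH shiftN //; exact: origin_good.1.
have im s : iter s (shift l) (origin l) = iter (s %% N.+1) (shift l) (origin l).
  by rewrite {1}(divn_eq s N.+1) addnC iterD it.
by rewrite im e // -im.
Qed.

Lemma reach_iter Psi k s : bmap rho B Psi -> reach rho a B k ->
  reach rho a B (iter s (vapply Psi) k).
Proof. by move=> hP kr; elim: s => //= s IH; apply: reach_vapply. Qed.

Definition axis d := point (fun l => if l == i0 then d else 0).

(** As [N] is -1 modulo [N.+1], translating [N * L k] times along [k] clears coordinate [k] and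
    subtracts [L k] at [i0]; translating back [L k] times gives reachability. *)
Lemma point_gather L :
  let d := L i0 + N * \sum_(k in K :\ i0) L k in
  (point L \in rho) = (axis d \in rho) /\ reach rho a B (point L).
Proof.
(* The exponents after the coordinates in [s] have been cleared; there [N.+1 * L l] stands for
   zero. *)
pose M s l := if l == i0 then L i0 + N * \sum_(k <- s) L k
              else if l \in s then N.+1 * L l else L l.
have H s : uniq s -> {subset s <= K :\ i0} ->
    (point L \in rho) = (point (M s) \in rho) /\
    (reach rho a B (point (M s)) -> reach rho a B (point L)).
  elim: s => [_ _|k s IH /= /andP[ks us] sub].
    suff -> : point (M [::]) = point L by [].
    by apply: eq_point_mod => l _; rewrite /M big_nil muln0 addn0; case: eqP => [->|].
  have {IH}[h1 h2] : (point L \in rho) = (point (M s) \in rho) /\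
    (reach rho a B (point (M s)) -> reach rho a B (point L)).
    by apply: IH => // l ls; apply: sub; rewrite inE ls orbT.
  have /andP[ki kK] : (k != i0) && (k \in K) by have := sub k (mem_head k s); rewrite !inE.
  have nk := negbTE ki; have nks := negbTE ks.
  have e1 : point (M (k :: s)) = point (fun l => M s l + N * L k * ((l == i0) || (l == k))).
    apply: eq_point_mod => l _; congr (_ %% _); rewrite /M big_cons inE.
    case: (l =P i0) => [_|_] /=; first by rewrite muln1 mulnDr -addnA; congr addn; apply: addnC.
    case: (l =P k) => [->|_] /=; last by rewrite muln0 addn0.
    by rewrite nks muln1 mulSn.
  have e2 : point (M s) = point (fun l => M (k :: s) l + L k * ((l == i0) || (l == k))).
    apply: eq_point_mod => l _; rewrite /M big_cons inE.
    case: (l =P i0) => [_|_] /=.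
      rewrite muln1 mulnDr -[LHS](modnMDl (L k)); congr (_ %% _).
      by rewrite mulnS; ring.
    case: (l =P k) => [->|_] /=; last by rewrite muln0 addn0.
    by rewrite nks muln1 mulnC modnMDl.
  split; first by rewrite e1 translate_point_rho.
  move=> hr; apply: h2; rewrite e2 -translate_point //.
  by apply: reach_iter => //; apply: translate_bmap.
have [|l|h1 h2] := H (enum (K :\ i0)); first exact: enum_uniq.
  by rewrite mem_enum.
move=> d; have e : point (M (enum (K :\ i0))) = axis d.
  apply: eq_point_mod => l lK; rewrite /M mem_enum !inE lK.
  case: (l =P i0) => [_|_] /=; first by rewrite big_enum.
  by rewrite modnMr mod0n.
by rewrite h1 e; split=> //; apply: h2; rewrite e; apply: point_reach_single.
Qed.

Lemma axis0 : axis 0 = origin.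
Proof.
apply/ffunP=> l; rewrite ffunE; case: ifP => lK; first by case: eqP.
by rewrite originE //; apply: contraFneq lK => ->.
Qed.

Lemma axis1 : axis 1 = a.
Proof.
apply/ffunP=> l; rewrite ffunE; case: ifP => // lK.
case: eqP => [->|/eqP li] /=; last exact: originE.
by rewrite /shift eqxx oadd.
Qed.

Lemma axis_mod d d' : d = d' %[mod N.+1] -> axis d = axis d'.
Proof. by move=> e; apply: eq_point_mod => l _; case: eqP. Qed.

Lemma modn_negneg y : N * (N * y) = y %[mod N.+1].
Proof.
apply/eqP; rewrite -(eqn_modDr (N * y)); apply/eqP.
by rewrite -[X in _ + X]mul1n -mulnDl addn1 modnMr -mulSn modnMr.
Qed.

(** Rectangularity at the point with exponents [x] at [i0] and -y, written [N * y], at [k]: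
    resetting either coordinate or both gives [axis y], [axis x], [origin], while the point itself
    gathers to [axis (x + y)]. *)
Lemma axis_add x y : axis x \in rho -> axis y \in rho -> axis (x + y) \in rho.
Proof.
move=> hx hy; have [k kK] := class_third i0 i0 K3; rewrite andbb => ki.
have nki := negbTE ki.
pose L x' y' l := if l == i0 then x' else if l == k then y' else 0.
have sumL x' y' : \sum_(l in K :\ i0) L x' y' l = y'.
  rewrite (bigD1 k) ?inE ?ki //= /L nki eqxx big1 ?addn0 // => l.
  by rewrite !inE => /andP[/andP[/negbTE -> _] /negbTE ->].
have Lrho x' y' : (point (L x' y') \in rho) = (axis (x' + N * y') \in rho).
  by have [-> _] := point_gather (L x' y'); rewrite sumL /L eqxx.
have : point (L x (N * y)) \in rho.
  apply: (rectK i0K kK (x := origin i0) (y := origin k)); first by rewrite eq_sym.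
  - suff -> : upd (point (L x (N * y))) i0 (origin i0) = point (L 0 (N * y)).
      by rewrite Lrho add0n (axis_mod (modn_negneg y)).
    by apply/ffunP=> l; rewrite [LHS]updE !pointE /L; case: eqP => [->|] //; rewrite i0K.
  - suff -> : upd (point (L x (N * y))) k (origin k) = point (L x 0).
      by rewrite Lrho muln0 addn0.
    by apply/ffunP=> l; rewrite [LHS]updE !pointE /L; case: (l =P k) => [->|] //; rewrite kK nki.
  - suff -> : upd (upd (point (L x (N * y))) i0 (origin i0)) k (origin k) = point (L 0 0).
      by rewrite Lrho muln0 axis0; exact: origin_good.2.
    apply/ffunP=> l; rewrite [LHS]updE !pointE /L; case: (l =P k) => [->|/eqP/negbTE lk].
      by rewrite kK nki.
    rewrite [LHS]updE pointE /L lk; case: eqP => [->|] //.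
    by rewrite i0K.
rewrite Lrho; suff -> : axis (x + N * (N * y)) = axis (x + y) by [].
by apply: axis_mod; rewrite -modnDmr modn_negneg modnDmr.
Qed.

(** The exponents in [rho] form a subgroup modulo [N.+1], and it is proper because [axis 1] is
    [a]. *)
Lemma axis_dvd : exists2 D, 1 < D & (D %| N.+1) /\ forall d, (axis d \in rho) = (D %| d).
Proof.
have a0 : axis 0 \in rho by rewrite axis0; exact: origin_good.2.
have axM x q : axis x \in rho -> axis (q * x) \in rho.
  by move=> hx; elim: q => // q IH; rewrite mulSn; apply: axis_add.
have aN : axis N.+1 \in rho by rewrite (@axis_mod _ 0) ?modnn ?mod0n.
have exD : exists d, (0 < d) && (axis d \in rho) by exists N.+1; rewrite aN.
pose D := ex_minn exD.
have [D0 Dr Dmin] : [/\ 0 < D, axis D \in rho &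
    forall d, 0 < d -> axis d \in rho -> D <= d].
  rewrite /D; case: ex_minnP => d /andP[d0 dr] dm; split=> // e e0 er.
  by apply: dm; rewrite e0 er.
have Ddvd d : (axis d \in rho) = (D %| d).
  apply/idP/idP => [dr|/dvdnP[q ->]]; last exact: axM.
  have : axis (d %% D) \in rho.
    (* Multiplying by [N] subtracts [d %/ D * D] without leaving [nat]. *)
    have := axis_add dr (axM _ (N * (d %/ D)) Dr); congr (_ \in rho).
    apply: axis_mod; rewrite {1}(divn_eq d D).
    rewrite -[RHS](modnMDl (d %/ D * D)); congr (_ %% _); ring.
  rewrite /dvdn; case: (posnP (d %% D)) => [->|h0 hr] //.
  by have := Dmin _ h0 hr; rewrite leqNgt ltn_mod D0.
exists D; last by split=> //; rewrite -Ddvd.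
rewrite ltn_neqAle D0 andbT; apply/eqP => D1.
by move: Dr; rewrite -D1 axis1 (negbTE (core_bad C)).
Qed.

End Addition.

(** With [D = q * p] and [p] prime, exponents restricted to multiples of [q] turn divisibility by
    [D] into a linear equation over ['Z_p]. *)
Lemma class_box i0 : i0 \in K -> 2 < #|K| ->
  exists (p : nat) (w : 'I_n -> 'Z_p -> A) (z0 : 'I_n -> 'Z_p),
  [/\ prime p, forall l z, l \in K -> w l z \in B l,
      forall l, l \in K -> injective (w l), plug K a w z0 = a &
      forall z, reach rho a B (plug K a w z) /\
        (plug K a w z \in rho <-> (\sum_(l in K) sgn i0 l * z l)%R = 0%R)].
Proof.
move=> i0K K3; have [add [addB addP addo oadd]] := class_add i0K K3.
have [N shiftN] := shift_order i0K K3 addB addP addo oadd.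
have [D D1 [DN Dax]] := axis_dvd i0K K3 addB addP addo oadd shiftN.
have gather := point_gather i0K K3 addB addP addo oadd shiftN.
have D0 : 0 < D := ltnW D1.
have [p pp [q Dq]] : exists2 p, prime p & exists q, D = q * p.
  by exists (pdiv D); [apply: pdiv_prime|apply/dvdnP/pdiv_dvd].
have p1 := prime_gt1 pp; have p0 := prime_gt0 pp.
have q0 : 0 < q by move: D0; rewrite Dq muln_gt0 => /andP[].
have Zdvd d : (p %| d) = ((d%:R : 'Z_p)%R == 0%R).
  by rewrite -val_eqE /= val_Zp_nat.
have pN : (N%:R : 'Z_p)%R = (-1)%R.
  apply/eqP; rewrite -subr_eq0 opprK -[X in (_ + X)%R](mulr1n 1%R) -natrD addn1 -Zdvd.
  by apply: dvdn_trans DN; rewrite Dq dvdn_mull.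
pose P (z : 'I_n -> 'Z_p) := point i0 add (fun l => q * z l).
have Prho z : (P z \in rho) = ((\sum_(l in K) sgn i0 l * z l)%R == 0%R).
  rewrite /P (gather _).1 Dax -big_distrr /= mulnCA -mulnDr Dq dvdn_pmul2l //.
  rewrite Zdvd natrD natrM pN natr_sum mulN1r natr_Zp [in RHS](bigD1 i0) //= {1}/sgn eqxx mul1r.
  congr (_ + _ == _)%R; rewrite -sumrN; apply: eq_big => [l|l].
    by rewrite !inE andbC.
  by rewrite !inE => /andP[/negbTE li _]; rewrite natr_Zp /sgn li mulN1r.
have Preach z : reach rho a B (P z) by case: (gather (fun l => q * z l)).
have PB z : boxed B (P z) by apply: point_boxed.
pose z1 (l : 'I_n) : 'Z_p := (if l == i0 then 1 else 0)%R.
have P1 : P z1 \notin rho.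
  rewrite Prho (bigD1 i0) //= big1 => [|l /andP[_ /negbTE li]].
    by rewrite /sgn /z1 eqxx mulr1 addr0 oner_eq0.
  by rewrite /z1 li mulr0.
(* So far the box need not contain [a] in the required position; [Th] moves its point [P z1],
   outside [rho], to [a], and is bijective because that point is reachable. *)
have [Th hT Th1] := core_key C (PB z1) P1.
have Tinj : binj B Th.
  by apply: reach_binj C _ _ (Preach z1) hT _; rewrite Th1; apply: core_bad C.
pose w l (z : 'Z_p) := Th l (iter (q * z) (shift i0 add l) (origin i0 l)).
have plugE z : plug K a w z = vapply Th (P z).
  apply/ffunP=> l; rewrite [LHS]ffunE [RHS]ffunE /P pointE; case: ifP => // lK.
  have := congr1 (fun t : tup => t l) Th1.
  by rewrite [X in X = _ -> _]ffunE /P pointE lK.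
have plug_rho z : plug K a w z \in rho <-> (\sum_(l in K) sgn i0 l * z l)%R = 0%R.
  rewrite plugE; split=> [h|h].
    by apply/eqP; rewrite -Prho; apply: binj_bad hT Tinj (PB z) h.
  by apply: hT.2 => //; rewrite Prho h.
exists p, w, z1; split=> //.
- by move=> l z lK; apply: hT.1; apply: iter_shiftB.
- move=> l lK z z' ww.
  have [k kK] := class_third l l K3; rewrite andbb => kl.
  (* Placed at a second coordinate [k], [c] balances [z] at [l]. If [w l z = w l z'], then [z'] is
     balanced by the same [c], so [z = z']. *)
  pose c : 'Z_p := (- (sgn i0 k * (sgn i0 l * z)))%R.
  pose y u j : 'Z_p := (if j == l then u else if j == k then c else 0)%R.
  have sumy u : (\sum_(j in K) sgn i0 j * y u j = sgn i0 l * u - sgn i0 l * z)%R.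
    rewrite (bigD1 l) //= (bigD1 k) /= ?kK ?kl // big1 => [|j].
      rewrite /y eqxx (negbTE kl) eqxx addr0 /c mulrN.
      by rewrite [X in (- X)%R]mulrA sgn_sq mul1r.
    by move=> /andP[/andP[_ /negbTE jl] /negbTE jk]; rewrite /y jl jk mulr0.
  have e : plug K a w (y z) = plug K a w (y z').
    apply/ffunP=> j; rewrite !ffunE; case: ifP => // _; rewrite /y.
    by case: eqP => [->|].
  have : plug K a w (y z) \in rho by apply/plug_rho; rewrite sumy subrr.
  rewrite e => /plug_rho; rewrite sumy -mulrBr => h.
  have := congr1 (fun v => (sgn i0 l * v)%R) h; rewrite mulrA sgn_sq mul1r mulr0.
  by move/eqP; rewrite subr_eq0 => /eqP.
- by rewrite plugE.
- by move=> z; rewrite {1}plugE; split=> //; apply: reach_vapply.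
Qed.

End LinearClass.

(** * Assembling the box from the class coordinates and the values [b] *)

Section Assembly.
Variables (A : finType) (n : nat) (rho : {set {ffun 'I_n -> A}}).
Variable a : {ffun 'I_n -> A}.
Hypothesis akey : is_key_tuple rho a.
Notation tup := {ffun 'I_n -> A}.

(** Compose a map to [a], the retraction onto the box, and a map of the box from [a] to [k]; the
    retraction is needed because [Om] preserves [rho] only on the box. *)
Lemma reach_key B r m (F : 'I_n -> ('I_m -> A) -> A) k :
  core rho a setT B r F -> reach rho a B k -> k \notin rho -> is_key_tuple rho k.
Proof.
move=> C [Om hO <-] kbad; split=> // al albad.
have [Psi [hP Pal]] := akey.2 al albad.
exists (fun l x => Om l (r l (Psi l x))); split=> [x xr|].
  have -> : vapply (fun l x => Om l (r l (Psi l x))) x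
          = vapply Om (vapply r (vapply Psi x)) by apply/ffunP=> l; rewrite !ffunE.
  apply: hO.2; first by move=> l; rewrite ffunE; apply: core_ret C _ _.
  by apply: (core_retP C); [apply: hP|move=> l; rewrite inE].
rewrite -Pal; apply/ffunP=> l; rewrite !ffunE; congr (Om l _).
have -> : Psi l (al l) = a l by rewrite -Pal ffunE.
by apply: (core_fix C); apply: core_base C _.
Qed.

Definition patch (x : tup) (b : 'I_n -> A) (S : {set 'I_n}) : tup :=
  [ffun l => if l \in S then b l else x l].

Definition nice_box (r : nat) := exists (B : 'I_n -> {set A}) (p : nat)
    (phi : 'I_n -> A -> 'Z_p) (b : 'I_n -> A),
    prime p /\ [/\
        (forall i : 'I_n, i < r ->
           {in B i &, injective (phi i)} /\
           (forall z : 'Z_p, exists2 x, x \in B i & phi i x = z)),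
        (forall i : 'I_n, r <= i -> b i != a i /\ B i = [set a i; b i]),
        (forall i, a i \in B i),
        (forall x : {ffun 'I_n -> A}, (forall i, x i \in B i) ->
           (x \in rho <->
              ((\sum_(i < n | (i < r)%N) phi i (x i))%R = 0%R \/
               exists i : 'I_n, r <= i /\ x i = b i))) &
        (forall g : {ffun 'I_n -> A}, (forall i, g i \in B i) -> g \notin rho ->
           is_key_tuple rho g)].

(** Every tuple of the box is a [plug] tuple patched by [b] on the set of later coordinates where it
    equals [b]: a nonempty patch forces membership, an empty one leaves the linear equation. *)
Lemma nice_box_intro r i0 p (w : 'I_n -> 'Z_p -> A) (z0 : 'I_n -> 'Z_p) (b : 'I_n -> A) :
    let K := [set i : 'I_n | i < r] in
    prime p -> (forall l, l \in K -> injective (w l)) -> plug K a w z0 = a ->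
    (forall z, plug K a w z \in rho <-> (\sum_(l in K) sgn i0 l * z l)%R = 0%R) ->
    (forall z, plug K a w z \notin rho -> is_key_tuple rho (plug K a w z)) ->
    (forall z S, S != set0 -> S \subset ~: K -> patch (plug K a w z) b S \in rho) ->
  nice_box r.
Proof.
move=> K pp winj wa plugP plugkey patchP.
have inK i : (i \in K) = (i < r) by rewrite inE.
(* The inverse of [w i]; the default 0 is taken only off its image. *)
pose idx i x : 'Z_p := odflt 0%R [pick z | w i z == x].
have idxK i z : i \in K -> idx i (w i z) = z.
  move=> iK; rewrite /idx; case: pickP => [z' /eqP /(winj i iK)//|/(_ z)].
  by rewrite eqxx.
pose B (i : 'I_n) := if i < r then w i @: setT else [set a i; b i].
(* The signs are absorbed into the bijections, so that the final equation is a plain sum. *)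
pose phi i x := (sgn i0 i * idx i x)%R.
have Bidx i x : i \in K -> x \in B i -> w i (idx i x) = x.
  by rewrite inK /B => ir; rewrite ir => /imsetP [z _ ->]; rewrite idxK ?inK.
have ba (i : 'I_n) : r <= i -> b i != a i.
  move=> ri; apply/eqP=> e.
  have : patch (plug K a w z0) b [set i] \in rho.
    by apply: patchP; rewrite ?sub1set ?inE -?leqNgt // -cards_eq0 cards1.
  rewrite wa; suff -> : patch a b [set i] = a by apply/negP; case: akey.
  by apply/ffunP=> l; rewrite ffunE inE; case: eqP => [->|].
have split_box (x : tup) : (forall i, x i \in B i) ->
    exists z S, [/\ x = patch (plug K a w z) b S, S \subset ~: K,
      (\sum_(i < n | (i < r)%N) phi i (x i) = \sum_(l in K) sgn i0 l * z l)%R &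
      S = set0 <-> ~ exists i : 'I_n, r <= i /\ x i = b i].
  move=> xB; pose S := [set l | (l \notin K) && (x l == b l)].
  exists (fun i => idx i (x i)), S; split.
  - apply/ffunP=> l; rewrite !ffunE [l \in S]inE.
    case: (boolP (l \in K)) => lK /=; first by rewrite Bidx.
    case: eqP => // /eqP xb; have := xB l.
    by rewrite /B -inK (negbTE lK) !inE (negbTE xb) orbF => /eqP.
  - by apply/subsetP=> l; rewrite inE => /andP[lK _]; rewrite inE.
  - by apply: eq_bigl => l; rewrite inK.
  - split=> [S0 [i [ri xi]]|no].
      have : i \in S by rewrite inE inK -leqNgt ri xi eqxx.
      by rewrite S0 inE.
    apply/setP=> l; rewrite [RHS]inE; apply/negP; rewrite inE inK -leqNgt.
    by move=> /andP[rl /eqP xl]; apply: no; exists l.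
have patch0 x : patch x b set0 = x by apply/ffunP=> l; rewrite ffunE inE.
exists B, p, phi, b; split=> //; split.
- move=> i; rewrite -inK => iK; split=> [x y xB yB|z].
    move=> /(congr1 (fun v => (sgn i0 i * v)%R)); rewrite /phi !mulrA sgn_sq !mul1r => e.
    by rewrite -(Bidx i x iK xB) -(Bidx i y iK yB) e.
  exists (w i (sgn i0 i * z)%R).
    by rewrite /B -inK iK; apply: imset_f; rewrite inE.
  by rewrite /phi idxK // mulrA sgn_sq mul1r.
- by move=> i ri; split; [apply: ba|rewrite /B ltnNge ri].
- move=> i; rewrite /B; case: ifP => ir; last by rewrite !inE eqxx.
  have := congr1 (fun t : tup => t i) wa; rewrite ffunE inK ir => <-.
  by apply: imset_f; rewrite inE.
- move=> x xB; have [z [S [xE SK -> S0]]] := split_box x xB.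
  case: (altP (S =P set0)) => [Se|Sn].
    rewrite xE Se patch0 plugP; split=> [|[//|ex]]; first by left.
    by have := S0.1 Se; rewrite xE Se patch0.
  rewrite {1}xE; split=> _; last exact: patchP.
  right; apply: NNPP => no; case/eqP: Sn; exact/S0.
- move=> g gB gbad; have [z [S [gE SK _ _]]] := split_box g gB.
  have S0 : S = set0.
    by apply/eqP/negPn/negP=> Sn; move: gbad; rewrite gE patchP.
  by move: gbad; rewrite gE S0 patch0; apply: plugkey.
Qed.

Variables (m : nat) (f : ('I_m -> A) -> A) (r : nat).
Hypotheses (fwnu : is_WNU f) (fpres : op_preserves f rho).
Let K := [set i : 'I_n | i < r].
Hypothesis rectK : forall i j (c : tup) x y, i \in K -> j \in K -> i != j ->
  upd c i x \in rho -> upd c j y \in rho -> upd (upd c i x) j y \in rho -> c \in rho.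
Hypothesis repair : forall i, exists x, upd a i x \in rho.
Hypothesis pairs : forall i j, i != j -> ~~ ((i \in K) && (j \in K)) ->
  exists ci cj,
    [/\ upd a i ci \in rho, upd a j cj \in rho & upd (upd a i ci) j cj \in rho].

Lemma nice_box_large : 2 < #|K| -> nice_box r.
Proof.
move=> K3; have [B [re [F C]]] := core_exists setT akey fwnu fpres.
have aB := core_base C.
have [x0 hx0] := fin_all_exists repair.
pose b0 i := re i (x0 i).
have b0B i : i \in K -> b0 i \in B i by move=> _; apply: core_ret C _ _.
have b0g i : i \in K -> upd a i (b0 i) \in rho.
  by move=> _; apply: (ret_upd C); rewrite ?inE.
have /set0Pn [i0 i0K] : K != set0 by rewrite -card_gt0 (ltn_trans _ K3).
have [p [w [z0 [pp wB winj wa hz]]]] := class_box C rectK b0B b0g i0K K3.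
have coll j : j \notin K -> collapsible rho B j.
  move=> jK; have ij : i0 != j by apply: contraNneq jK => <-.
  have pairs' i k : i != k -> k \notin K -> exists ci ck,
      [/\ upd a i ci \in rho, upd a k ck \in rho & upd (upd a i ci) k ck \in rho].
    by move=> ik kK; apply: pairs; rewrite // (negbTE kK) andbF.
  have [ci [cj [h1 h2 h3 h4 h5]]] := pairsB pairs' C ij jK (in_setT _) (in_setT _).
  exact: (class_collapsible C rectK b0B b0g K3 i0K ij h1 h2 h3 h4 h5).
have [b hb] : exists b : 'I_n -> A, forall j, j \notin K -> b j \in B j /\
    forall k, boxed B k -> k j = a j -> k \in rho \/ reach rho a B k ->
      upd k j (b j) \in rho.
  apply: (fin_all_exists (P := fun j c => j \notin K -> c \in B j /\
    forall k, boxed B k -> k j = a j -> k \in rho \/ reach rho a B k ->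
      upd k j c \in rho)) => j.
  case: (boolP (j \in K)) => [_|jK]; first by exists (a j).
  by have [c cB hc] := collapsible_val C (coll j jK); exists c.
have plugB z : boxed B (plug K a w z).
  by move=> l; rewrite ffunE; case: ifP => [/wB|_]; [apply|apply: aB].
apply: (nice_box_intro (i0 := i0) (b := b) pp winj wa) => [z|z|z S]; rewrite -/K.
- by case: (hz z).
- by apply: (reach_key C); case: (hz z).
have [k] := ubnP #|S|; elim: k S => // k IH S ltk /set0Pn [j jS] SK.
have jK : j \notin K by have := subsetP SK j jS; rewrite inE.
have [bj hj] := hb j jK.
have patchE : patch (plug K a w z) b S = upd (patch (plug K a w z) b (S :\ j)) j (b j).
  apply/ffunP=> l; rewrite !ffunE !inE; case: (l =P j) => [->|] //=.
  by rewrite jS.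
have SjK : S :\ j \subset ~: K by apply: subset_trans SK; apply: subD1set.
rewrite patchE; apply: hj.
- move=> l; rewrite ffunE; case: ifP => [lS|_]; last exact: plugB.
  have lK : l \notin K by have := subsetP SjK l lS; rewrite inE.
  by case: (hb l lK).
- by rewrite ffunE in_setD1 eqxx ffunE (negbTE jK).
(* The first coordinate is patched into a reachable [plug] tuple, each further one into a tuple
   already in [rho]. *)
case: (altP (S :\ j =P set0)) => [->|Sn].
  right; suff -> : patch (plug K a w z) b set0 = plug K a w z by case: (hz z).
  by apply/ffunP=> l; rewrite ffunE inE.
left; apply: IH => //; rewrite -ltnS (leq_trans _ ltk) // ltnS.
by rewrite [X in _ < X](cardsD1 j) jS.
Qed.

Lemma Z2_eq (u v : 'Z_2) : (u == v) = ((u == 0%R) == (v == 0%R)).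
Proof. by case: u => [[|[|]]] // ?; case: v => [[|[|]]]. Qed.

Lemma nice_box_small i0 : i0 \in K -> #|K| <= 2 -> nice_box r.
Proof.
(* A one-element class is a trivial pattern, so [E] is then empty. *)
move=> i0K K2; pose E := if #|K| == 2 then K else set0.
have EK : E \subset K by rewrite /E; case: ifP => // _; apply: sub0set.
have E02 : E = set0 \/ exists i j, i != j /\ E = [set i; j].
  by rewrite /E; case: cards2P => h; [right|left].
have pairsE i j : i != j -> j \notin E -> exists ci cj,
    [/\ upd a i ci \in rho, upd a j cj \in rho & upd (upd a i ci) j cj \in rho].
  move=> ij jE; apply: pairs => //; apply/andP=> -[iK jK].
  have ijK : [set i; j] \subset K by apply/subsetP=> l; rewrite !inE => /orP[] /eqP ->;
    move: iK jK; rewrite !inE.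
  have := subset_leq_card ijK; rewrite cards2 ij => K2'.
  by move: jE; rewrite /E eqn_leq K2 K2' jK.
have abad := akey.1.
have rectE i j x y : i \in E -> j \in E -> i != j -> upd a i x \in rho ->
    upd a j y \in rho -> upd (upd a i x) j y \notin rho.
  move=> /(subsetP EK) iK /(subsetP EK) jK ij xr yr; apply/negP=> xyr.
  by move: abad; rewrite (rectK iK jK ij xr yr xyr).
have [b0 hb0] := witness_exists E02 repair pairsE rectE akey fwnu fpres setT.
have [B [re [F C]]] := core_exists setT akey fwnu fpres.
pose b i := re i (b0 i).
have bB i : b i \in B i by apply: core_ret C _ _.
have hb (T : {set 'I_n}) : T != set0 -> T != E -> overwrite a b T \in rho.
  by move=> T0 TE; apply: (ret_overwrite C); rewrite ?subsetT //; apply: hb0; rewrite ?subsetT.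
have b1 i : upd a i (b i) \in rho.
  rewrite -overwrite1; apply: hb; last exact: set1_neqE E02 _.
  by rewrite -cards_eq0 cards1.
have ba i : b i != a i by apply/eqP=> e; move: (b1 i); rewrite e upd_id (negbTE abad).
(* The roles of 0 and 1 are exchanged at [i0], so that the sum is 0 exactly when the set [T z] of
   coordinates holding [b] is neither empty nor [E], and [a] itself has sum 1. *)
pose w l (z : 'Z_2) := if (l == i0) == (z == 0%R) then b l else a l.
pose T (z : 'I_n -> 'Z_2) := [set l in K | (l == i0) == (z l == 0%R)].
have plugE z : plug K a w z = overwrite a b (T z).
  by apply/ffunP=> l; rewrite !ffunE [l \in T z]inE; case: (l \in K).
have TK z : T z \subset K by apply/subsetP=> l; rewrite inE => /andP[].
have Ebad : overwrite a b E \notin rho.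
  case: E02 => [->|[i [j [ij EE]]]]; first by rewrite overwrite0.
  have -> : overwrite a b E = upd (upd a i (b i)) j (b j).
    apply/ffunP=> l; rewrite !ffunE EE !inE.
    by case: (l =P j) => [->|_]; rewrite ?orbT ?orbF //; case: eqP => [->|].
  by apply: rectE; rewrite ?EE ?inE ?eqxx ?orbT.
have plug_rho z : (plug K a w z \in rho) = (T z != set0) && (T z != E).
  rewrite plugE; apply/idP/andP => [h|[]]; last exact: hb.
  split; apply/eqP=> e; move: h; rewrite e ?overwrite0 ?(negbTE abad) //.
  by rewrite (negbTE Ebad).
have sumE z : (\sum_(l in K) sgn i0 l * z l == 0 :> 'Z_2)%R = (T z != set0) && (T z != E).
  have iT : (i0 \in T z) = (z i0 == 0%R) by rewrite inE i0K eqxx; case: (z i0 == 0%R).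
  move: K2; rewrite leq_eqVlt => /orP[KE|K1].
    have /set0Pn [i1] : K :\ i0 != set0.
      by rewrite -card_gt0; move: (eqP KE); rewrite (cardsD1 i0) i0K add1n => -[->].
    rewrite in_setD1 => /andP[i10 i1K].
    have K01 : K = [set i0; i1].
      apply/esym/eqP; rewrite eqEcard (eqP KE) cards2 eq_sym i10 andbT.
      by apply/subsetP=> l; rewrite in_set2 => /orP[] /eqP ->.
    have i1T : (i1 \in T z) = (z i1 != 0%R).
      by rewrite inE i1K (negbTE i10); case: (z i1 == 0%R).
    have i01 : i0 \notin [set i1] by rewrite in_set1 eq_sym.
    rewrite {1}K01 big_setU1 //= big_set1 /sgn eqxx (negbTE i10) mul1r mulN1r.
    rewrite subr_eq0 Z2_eq /E KE.
    have -> : (T z != set0) = (i0 \in T z) || (i1 \in T z).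
      apply/set0Pn/orP => [[l lT]|[h|h]]; [|by exists i0|by exists i1].
      have := subsetP (TK z) l lT; rewrite {1}K01 in_set2.
      by case/orP=> /eqP e; move: lT; rewrite e => ->; [left|right].
    have -> : (T z == K) = (i0 \in T z) && (i1 \in T z).
      apply/eqP/andP => [->//|[h0 h1]]; apply/eqP; rewrite eqEsubset TK {1}K01.
      by apply/subsetP=> l; rewrite in_set2 => /orP[] /eqP ->.
    by rewrite iT i1T; case: (z i0 == 0%R); case: (z i1 == 0%R).
  have K1' : K = [set i0].
    by apply/esym/eqP; rewrite eqEcard sub1set i0K cards1.
  have -> : E = set0 by rewrite /E K1' cards1.
  rewrite andbb {1}K1' big_set1 /sgn eqxx mul1r -iT.
  apply/idP/set0Pn => [h|[l lT]]; first by exists i0.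
  by have := subsetP (TK z) l lT; rewrite {1}K1' inE => /eqP <-.
apply: (@nice_box_intro r i0 2 w (fun l => if l == i0 then 1 else 0)%R b); rewrite -/K //.
- move=> l _ u v; rewrite /w => e; apply/eqP; rewrite Z2_eq; move: e.
  have nab := negbTE (ba l); have nba : (a l == b l) = false by rewrite eq_sym.
  case: (l == i0); case: (u == 0%R); case: (v == 0%R) => //= /eqP; by rewrite ?nab ?nba.
- rewrite plugE; suff -> : T (fun l => if l == i0 then 1 else 0)%R = set0.
    exact: overwrite0.
  by apply/setP=> l; rewrite inE [RHS]inE; case: (l == i0); rewrite ?andbF.
- by move=> z; rewrite plug_rho -sumE; split=> /eqP.
- move=> z; rewrite plug_rho negb_and !negbK => h.
  have zbad : plug K a w z \notin rho by rewrite plug_rho negb_and !negbK.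
  case/orP: h => /eqP e; move: zbad; rewrite plugE e ?overwrite0 // => zbad.
  by apply: (reach_key C) zbad; apply: (reach_overwriteE E02 rectE C) => // i _.
- move=> z S S0 SK.
  suff -> : patch (plug K a w z) b S = overwrite a b (T z :|: S).
    have [l lS] := set0Pn _ S0.
    apply: hb; first by apply/set0Pn; exists l; rewrite in_setU lS orbT.
    apply/eqP=> e; have : l \in E by rewrite -e in_setU lS orbT.
    by move/(subsetP EK); have := subsetP SK l lS; rewrite in_setC => /negbTE ->.
  apply/ffunP=> l; rewrite plugE !ffunE in_setU; case: (l \in S); rewrite ?orbT //.
  by rewrite orbF.
Qed.

End Assembly.

(** * From essentiality, keyness and the pattern to the repair conditions *)

Lemma essential_repairable (A : finType) (n : nat) (rho : {set {ffun 'I_n -> A}}) :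
    essential rho ->
  exists2 c : {ffun 'I_n -> A}, c \notin rho & forall i, exists x, upd c i x \in rho.
Proof.
move=> ess; apply: NNPP => no; apply: ess.
(* If every tuple outside [rho] had an unrepairable coordinate, [rho] would be the conjunction of
   its [n] projections that each forget one coordinate. *)
pose proj (l : 'I_n) (x : {ffun 'I_n -> A}) : {ffun 'I_n.-1 -> A} :=
  [ffun j => x (lift l j)].
exists n, (fun _ => n.-1), (fun l => lift l), (fun l => proj l @: rho).
split=> [l|x]; first by case: n l {rho no proj} => [[]|].
split=> [xr l|h]; first exact: (imset_f (proj l)).
apply/negPn/negP=> xbad; apply: no; exists x => // i.
have /imsetP [y yr e] := h i; exists (y i).
suff -> : upd x i (y i) = y by [].
apply/ffunP=> l; rewrite updE; case: (unliftP i l) => [j ->|->]; last by rewrite eqxx.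
have := congr1 (fun t : {ffun 'I_n.-1 -> A} => t j) e; rewrite !ffunE => ->.
by rewrite eq_sym (negbTE (neq_lift _ _)).
Qed.

Unset Implicit Arguments.

Theorem mainTheorem4 (A : finType) (n r : nat) (rho : {set {ffun 'I_n -> A}}) :
  3 <= n -> 1 <= r <= n ->
  essential rho -> key_relation rho ->
  (exists (m : nat) (f : ('I_m -> A) -> A), is_WNU f /\ op_preserves f rho) ->
  (forall i j : 'I_n, pattern rho i j <-> (i = j \/ (i < r /\ j < r))) ->
  forall a : {ffun 'I_n -> A}, is_key_tuple rho a ->
  exists (B : 'I_n -> {set A}) (p : nat) (phi : 'I_n -> A -> 'Z_p) (b : 'I_n -> A),
    prime p /\ [/\
        (forall i : 'I_n, i < r ->
           {in B i &, injective (phi i)} /\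
           (forall z : 'Z_p, exists2 x, x \in B i & phi i x = z)),
        (forall i : 'I_n, r <= i -> b i != a i /\ B i = [set a i; b i]),
        (forall i, a i \in B i),
        (forall x : {ffun 'I_n -> A}, (forall i, x i \in B i) ->
           (x \in rho <->
              ((\sum_(i < n | (i < r)%N) phi i (x i))%R = 0%R \/
               exists i : 'I_n, r <= i /\ x i = b i))) &
        (forall g : {ffun 'I_n -> A}, (forall i, g i \in B i) -> g \notin rho ->
           is_key_tuple rho g)].
Proof.
move=> n3 /andP[r1 rn] ess _ [m [f [fwnu fpres]]] pat a akey.
pose K := [set i : 'I_n | i < r].
have rectK i j (c : {ffun 'I_n -> A}) x y : i \in K -> j \in K -> i != j ->
  upd c i x \in rho -> upd c j y \in rho -> upd (upd c i x) j y \in rho -> c \in rho.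
  rewrite !inE => ir jr ij h1 h2 h3; apply/negPn/negP=> cbad.
  have /(pat i j) [e|[_ []]] : i = j \/ i < r /\ j < r by right.
    by rewrite e eqxx in ij.
  by exists c, x, y.
(* Keyness of [a] transports the repairs of the tuple [c] found by essentiality to [a]; the
   pattern's counterexamples are transported likewise below. *)
have repair i : exists x, upd a i x \in rho.
  have [c cbad hc] := essential_repairable ess.
  have [Psi [hP <-]] := akey.2 c cbad; have [x xr] := hc i.
  by exists (Psi i x); rewrite -vapply_upd; apply: hP.
have pairs i j : i != j -> ~~ ((i \in K) && (j \in K)) -> exists ci cj,
    [/\ upd a i ci \in rho, upd a j cj \in rho & upd (upd a i ci) j cj \in rho].
  move=> ij; rewrite !inE => ijr; apply: NNPP => no.
  have /(pat i j) [e|[ir jr]] : pattern rho i j.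
  - right; split; first by apply/eqP.
    move=> [c [x [y [cbad h1 h2 h3]]]]; apply: no.
    have [Psi [hP <-]] := akey.2 c cbad.
    by exists (Psi i x), (Psi j y); split; rewrite -!vapply_upd; apply: hP.
  - by rewrite e eqxx in ij.
  - by rewrite ir jr in ijr.
have n0 : 0 < n := ltn_trans (isT : 0 < 2) n3.
case: (leqP #|K| 2) => [K2|K3].
  apply: (nice_box_small akey fwnu fpres rectK repair pairs _ K2 (i0 := Ordinal n0)).
  by rewrite inE.
exact: (nice_box_large akey fwnu fpres rectK repair pairs K3).
Qed.
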